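(* Let $\Omega\subset\mathbb{R}^N$, $\Lambda>\lambda>0$, $f$, $g$ and $\varepsilon>0$ be as fixed in the context, and let $u^\varepsilon$ be the value function of the game described there. Then $u^\varepsilon$ satisfies $$u^\varepsilon(x) = -\frac{1}{2N}\varepsilon^2 f(x) + \frac{1}{2N}\sup_{v_i,\mu_i}\sum_{i=1}^N\Big[u^\varepsilon(x+\varepsilon\mu_i v_i)+u^\varepsilon(x-\varepsilon\mu_i v_i)\Big]\qquad\text{for } x\in\Omega,$$ $$u^\varepsilon(x)=g(x)\qquad\text{for } x\in\mathbb{R}^N\setminus\Omega,$$ where the supremum is taken over all orthonormal bases $(v_1,\dots,v_N)$ of $\mathbb{R}^N$ and all choices $\mu_i\in\{\sqrt{\lambda},\sqrt{\Lambda}\}$, $i=1,\dots,N$.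
   Context: Setting. $\Omega\subset\mathbb{R}^N$ is a bounded domain satisfying a uniform exterior sphere condition: there is $\delta>0$ such that for every $y\in\partial\Omega$ there is a ball $B_\delta(z)\subset\mathbb{R}^N\setminus\Omega$ with $y\in\partial B_\delta(z)$. The constants satisfy $\Lambda>\lambda>0$. The running payoff $f:\Omega\to\mathbb{R}$ is uniformly continuous and bounded; the final payoff $g:\mathbb{R}^N\setminus\Omega\to\mathbb{R}$ is continuous and bounded. The game. Fix $\varepsilon>0$. A token starts at $x_0$. At each step, with the token at $x_n\in\Omega$, the single player chooses an orthonormal basis $v_1,\dots,v_N$ of $\mathbb{R}^N$ and, for each $i$, a number $\mu_i\in\{\sqrt\lambda,\sqrt\Lambda\}$; the next position $x_{n+1}$ is then each of the $2N$ points $x_n\pm\varepsilon\mu_i v_i$ ($i=1,\dots,N$) with probability $\frac{1}{2N}$. The game ends at the first time $\tau=\min\{k\ge 0: x_k\notin\Omega\}$ (so $\tau=0$ if $x_0\notin\Omega$). A strategy $S_I$ is a Borel function of the partial histories, $S_I(x_0,\dots,x_n)=(v_1,\dots,v_N,\mu_1,\dots,\mu_N)$. A strategy $S_I$ and a starting point $x_0$ determine, via these transition probabilities, a probability measure $\mathbb{P}^{x_0}_{S_I}$ on game sequences, with expectation $\mathbb{E}^{x_0}_{S_I}$; under every strategy $\tau$ is finite almost surely with finite expectation. The value of the game is $$u^\varepsilon(x_0)=\sup_{S_I}\mathbb{E}^{x_0}_{S_I}\Big[g(x_\tau)-\frac{1}{2N}\varepsilon^2\sum_{k=0}^{\tau-1}f(x_k)\Big],$$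 so that for $x_0\notin\Omega$, where $\tau=0$, the payoff is $g(x_0)$. *)

(* Defs.v *)
From HB Require Import structures.
From mathcomp Require Import all_boot all_order all_algebra.
From mathcomp Require Import all_classical all_reals all_analysis.

Set Implicit Arguments.
Unset Strict Implicit.
Unset Printing Implicit Defensive.
Import Order.TTheory GRing.Theory Num.Theory.
Import numFieldNormedType.Exports.
Local Open Scope classical_set_scope.
Local Open Scope ring_scope.

(* Matrices, in particular row vectors, carry their Borel sigma-algebra. *)
Section borel_matrix.
Variables (R : realType) (m n : nat).

HB.instance Definition _ := @isMeasurable.Build
  (sigma_display (@open 'M[R]_(m, n))) 'M[R]_(m, n) <<s @open 'M[R]_(m, n) >>
  (@sigma_algebra0 _ setT _) (@sigma_algebraC _ _)
  (@sigma_algebra_bigcup _ setT _).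

End borel_matrix.

Section geometry.
Variables (R : realType) (N : nat).
Implicit Types (x y z : 'rV[R]_N) (Omega : set 'rV[R]_N).

(* The Euclidean norm; the library norm `|x| on 'rV[R]_N is the sup norm. *)
Definition enorm x : R := Num.sqrt (\sum_(i < N) x 0 i ^+ 2).

Definition bounded_domain Omega : Prop :=
  [/\ open Omega, connected Omega, Omega !=set0 & bounded_set Omega].

Definition uniform_exterior_sphere Omega : Prop :=
  exists2 delta : R, 0 < delta &
    forall y, (closure Omega `\` interior Omega) y ->
      exists2 z, (forall x, enorm (x - z) < delta -> ~ Omega x) &
        enorm (y - z) = delta.

Definition uniformly_continuous_on Omega (f : 'rV[R]_N -> R) : Prop :=
  forall e : R, 0 < e -> exists2 d : R, 0 < d &
    forall x y, Omega x -> Omega y -> enorm (x - y) < d -> `|f x - f y| < e.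

End geometry.

Section game.
Variables (R : realType) (N : nat).
Implicit Types (x : 'rV[R]_N) (Omega : set 'rV[R]_N) (lam Lam eps : R).

(* A move a = (v, mu): the i-th row of the matrix a.1 is v_i, and
   a.2 0 i is mu_i. *)
Local Notation move := ('M[R]_N * 'rV[R]_N)%type.

Definition orthonormal_basis (v : 'M[R]_N) : Prop :=
  forall i j, \sum_(k < N) v i k * v j k = (i == j)%:R.

Definition admissible lam Lam : set move :=
  [set a : move | orthonormal_basis a.1 /\
           forall i : 'I_N, a.2 0 i = Num.sqrt lam \/ a.2 0 i = Num.sqrt Lam].

Definition displacement eps (a : move) (i : 'I_N) : 'rV[R]_N :=
  (eps * a.2 0 i) *: row i a.1.

(* Game sequences, with the sigma-algebra generated by the coordinates. *)
Definition cylinders : set (set (nat -> 'rV[R]_N)) :=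
  [set [set w | B (w k)] | k in [set: nat] & B in measurable].

Local Notation trajectory := (g_sigma_algebraType cylinders).

Definition history (n : nat) (w : trajectory) : n.+1.-tuple 'rV[R]_N :=
  [tuple w k | k < n.+1].

Definition strategy : Type := forall n : nat, n.+1.-tuple 'rV[R]_N -> move.

Definition borel_strategy lam Lam (S : strategy) : Prop :=
  forall n, measurable_fun [set: n.+1.-tuple 'rV[R]_N] (S n) /\
            forall h, admissible lam Lam (S n h).

(* The law of the next position. Once the game has ended the token is kept at
   its exit position, so that infinite sequences are defined; the payoff does
   not see the positions after the exit time. *)
Definition transition Omega eps x (a : move) (B : set 'rV[R]_N) : \bar R :=
  if `[< Omega x >] then
    (((2 * N)%:R^-1)%:E * \sum_(i < N) (\d_(x + displacement eps a i)%R B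
                                      + \d_(x - displacement eps a i)%R B))%E
  else \d_x B.

(* P is the measure determined by the strategy S and the starting point x0:
   the sequence starts at x0, and transition is the conditional law of the
   position n + 1 given the positions 0, ..., n. *)
Definition game_measure Omega eps (S : strategy) x0
    (P : probability trajectory R) : Prop :=
  P [set w : trajectory | w 0%N = x0] = 1%E /\
  forall (n : nat) (A : set (n.+1.-tuple 'rV[R]_N)) (B : set 'rV[R]_N),
    measurable A -> measurable B ->
    P [set w : trajectory | A (history n w) /\ B (w n.+1)] =
    (\int[P]_(w in [set w : trajectory | A (history n w)])
       transition Omega eps (w n) (S n (history n w)) B)%E.

(* The exit time is ex_minn; sequences that never leave Omega form a null set,
   on which the payoff is set to 0. *)
Definition payoff Omega eps (f g : 'rV[R]_N -> R) (w : trajectory) : R :=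
  match pselect (exists n, `[< ~ Omega (w n) >]) with
  | left exits =>
      let tau := ex_minn exits in
      g (w tau) - (2 * N)%:R^-1 * eps ^+ 2 * \sum_(k < tau) f (w k)
  | right _ => 0
  end.

Definition game_value Omega lam Lam eps (f g : 'rV[R]_N -> R) x0 : \bar R :=
  ereal_sup [set e | exists (S : strategy) (P : probability trajectory R),
    [/\ borel_strategy lam Lam S, game_measure Omega eps S x0 P &
        e = ('E_P[payoff Omega eps f g])%E]].

End game.

(* Main.v *)
From HB Require Import structures.
Require Import Defs.
From mathcomp Require Import all_boot all_order all_algebra.
From mathcomp Require Import all_classical all_reals all_analysis.
From mathcomp Require Import measurable_realfun ring lra.
Import Order.TTheory GRing.Theory Num.Theory.
Import numFieldNormedType.Exports.
Local Open Scope classical_set_scope.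
Local Open Scope ring_scope.

Set Implicit Arguments.
Unset Strict Implicit.
Unset Printing Implicit Defensive.

(** The dynamic programming principle is proved by first step analysis.  After one
    move the token is at one of 2N points, chosen uniformly.  Two operations on
    games follow.

    Conditioning (game_measure_first_step): a game from x in Omega, conditioned on
    its second position y, is a game from y played with the remaining strategy,
    and the original law is the average of these conditional laws.  So its
    expected payoff is the running cost at x plus the average of the payoffs of
    games from the successors, each at most the value there.  This bounds the
    value by the right-hand side.

    Splicing (spliced_game_measure): a first move and a game from each of its
    successors combine into one game from x.  With nearly optimal games from the
    successors this gives the reverse inequality.  The value function need not
    be measurable and no measurable selection is made: the spliced strategy
    distinguishes finitely many second positions, so it is Borel as soon as its
    pieces are.

    Three analytic facts support this.  The expected exit time is bounded
    uniformly over strategies and starting points (sum_alive_le_potential),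
    because the squared norm of the position grows on average by at least
    eps^2 lam per step while the domain is bounded; this makes payoffs
    integrable, with a uniform bound on their expectations, and makes infinite
    games negligible.  The payoff is measurable (measurable_payoff).  Finally, at
    least one game exists from every point (constant_game_measure_ex), so that
    the value is not -oo: a random walk with a constant move is driven by the
    digits of a uniform random variable in base 2N (markov_chain_ex). *)

(** * Borel sets of matrices *)

Section borel_matrix_theory.
Context {R : realType} {m n : nat}.

Lemma open_measurable_mx (U : set 'M[R]_(m, n)) : open U -> measurable U.
Proof. by move=> oU; exact: sub_sigma_algebra. Qed.

Lemma continuous_measurable_fun_mx (D : set 'M[R]_(m, n))
    (f : 'M[R]_(m, n) -> R) : measurable D ->
  {within D, continuous f} -> measurable_fun D f.
Proof.
move=> mD /continuousP cf; apply: (measurability _ (RGenOpens.measurableE R)).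
move=> _ [_ [a [b ->] <-]].
have /open_subspaceP[V oV VD] := cf _ (@interval_open _ (BRight a) (BLeft b) isT isT).
by rewrite setIC -VD; apply: measurableI => //; exact: open_measurable_mx.
Qed.

Lemma measurable_coord i j : measurable_fun setT (fun x : 'M[R]_(m, n) => x i j).
Proof.
apply: continuous_measurable_fun_mx => //.
by apply: continuous_subspaceT => x; exact: coord_continuous.
Qed.

Lemma measurable_set1_mx (x : 'M[R]_(m, n)) : measurable [set x].
Proof.
have -> : [set x] = \bigcap_(ij in [set: 'I_m * 'I_n])
    ((fun y : 'M[R]_(m, n) => y ij.1 ij.2) @^-1` [set x ij.1 ij.2]).
  apply/seteqP; split=> [_ -> //|y xy]; apply/matrixP => i j.
  exact: (xy (i, j)).
apply: fin_bigcap_measurable => // ij _.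
by rewrite -[X in measurable X]setTI; exact: measurable_coord.
Qed.

(** The topology of matrices is second countable: an open set is the union of
    the countably many boxes with rational centre and radius 1/(k+1) that it
    contains, and each box only involves the entries.  Hence the entries already
    generate the Borel sigma-algebra. *)
Lemma measurable_fun_mx d (T : measurableType d) (D : set T)
    (f : T -> 'M[R]_(m, n)) :
  (forall i j, measurable_fun D (fun t => f t i j)) -> measurable_fun D f.
Proof.
move=> mf mD; apply: (@measurability _ _ _ _ D f (@open 'M[R]_(m, n))) (mD) => //.
move=> _ [U oU <-].
pose B (q : 'M[rat]_(m, n)) (k : nat) : set 'M[R]_(m, n) :=
  [set x | forall i j, `|ratr (q i j) - x i j| < k.+1%:R^-1].
(* p encodes a centre and a radius; all other codes give the empty set *)
pose E (p : nat) := if unpickle p is Some qk then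
    if `[< B qk.1 qk.2 `<=` U >] then B qk.1 qk.2 else set0 else set0.
have UE : U = \bigcup_p E p.
  apply/seteqP; split=> [x Ux|x [p _]]; last first.
    by rewrite /E; case: unpickle => // qk; case: asboolP => // sub /sub.
  have /nbhs_ballP[e /= e0 xeU] : nbhs x U by exact: open_nbhs_nbhs.
  (* two points of a box of radius 1/(k+1) are within 2/(k+1) < e *)
  pose k := Num.truncn (2 / e).
  have ke : 2 * k.+1%:R^-1 < e.
    rewrite ltr_pdivrMr ?ltr0n// mulrC -ltr_pdivrMr//.
    by rewrite truncnS_gt.
  have k0 : 0 < k.+1%:R^-1 :> R by rewrite invr_gt0.
  have /choice[q qx] : forall ij : 'I_m * 'I_n,
      exists r : rat, `|ratr r - x ij.1 ij.2| < k.+1%:R^-1.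
    move=> [i j] /=; have : x i j < x i j + k.+1%:R^-1 by rewrite ltrDl.
    move=> /rat_in_itvoo[r]; rewrite in_itv /= => /andP[xr rx].
    by exists r; rewrite ltr_distl rx andbT (lt_trans _ xr)// ltrBlDr ltrDl.
  pose Q : 'M[rat]_(m, n) := \matrix_(i, j) q (i, j).
  have BU : B Q k `<=` U.
    move=> y Qy; apply: xeU; split => // i j.
    rewrite -ball_normE /=; have := qx (i, j); have := Qy i j; rewrite mxE /=.
    have := ler_normB (ratr (q (i, j)) - y i j) (ratr (q (i, j)) - x i j).
    rewrite [X in `|X| <= _](_ : _ = x i j - y i j); last by ring.
    move=> le qy_lt qx_lt; apply: le_lt_trans le (lt_trans _ ke).
    by rewrite mulr_natl mulr2n ltrD.
  exists (pickle (Q, k)) => //; rewrite /E pickleK /= asboolT// => i j.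
  by rewrite mxE; exact: (qx (i, j)).
rewrite UE preimage_bigcup setI_bigcupr; apply: bigcupT_measurable => p.
rewrite /E; case: unpickle => [[q k] /=|]; last by rewrite preimage_set0 setI0.
case: ifP => _; last by rewrite preimage_set0 setI0.
have -> : D `&` f @^-1` B q k =
   D `&` \bigcap_(ij in [set: 'I_m * 'I_n])
     (D `&` [set t | `|ratr (q ij.1 ij.2) - f t ij.1 ij.2| < k.+1%:R^-1]).
  apply/seteqP; split=> t [Dt fB]; split=> //.
  - by move=> [i j] _; split => //; exact: fB.
  - by move=> i j; have [] := fB (i, j) I.
apply: measurableI => //; apply: fin_bigcap_measurable => // ij _.
have : measurable_fun D (fun t => `|ratr (q ij.1 ij.2) - f t ij.1 ij.2|).
  apply: measurableT_comp => //; apply: measurable_funB => //; exact: mf.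
move=> /(_ mD `]-oo, k.+1%:R^-1[%classic (measurable_itv _)).
by congr measurable; apply/seteqP; split => t /=; rewrite in_itv.
Qed.

End borel_matrix_theory.

(** * Trajectories *)

Section trajectories.
Context {R : realType} {N : nat}.
Local Notation traj := (g_sigma_algebraType (@cylinders R N)).
Implicit Types (x : 'rV[R]_N) (w : traj).

Lemma measurable_position k : measurable_fun setT (fun w : traj => w k).
Proof.
by move=> _ B mB; rewrite setTI; apply: sub_sigma_algebra; exists k => //; exists B.
Qed.

Lemma measurable_fun_traj d (T : measurableType d) (phi : T -> traj) :
  (forall k, measurable_fun setT (fun t => phi t k)) -> measurable_fun setT phi.
Proof.
move=> mphi; apply: (@measurability _ _ _ _ setT phi (@cylinders R N)) => //.
by move=> _ [_ [k _ [B mB <-]] <-]; exact: mphi.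
Qed.

Definition prepend x w : traj := fun k => if k is k'.+1 then w k' else x.

Definition tail w : traj := fun k => w k.+1.

Lemma measurable_prepend x : measurable_fun setT (prepend x).
Proof.
by apply: measurable_fun_traj => -[|k]; [exact: measurable_cst|
  exact: measurable_position].
Qed.

Lemma measurable_tail : measurable_fun setT tail.
Proof. by apply: measurable_fun_traj => k; exact: measurable_position. Qed.

Lemma measurable_history n : measurable_fun setT (@history R N n).
Proof.
apply/measurable_fun_tnthP => i.
rewrite (_ : _ \o _ = fun w : traj => w i); first exact: measurable_position.
by apply/funext => w /=; rewrite tnth_mktuple.
Qed.

Lemma history_prepend n x w :
  history n.+1 (prepend x w) = cons_tuple x (history n w).
Proof.
apply/eq_from_tnth => i; rewrite tnth_mktuple.
case: (unliftP ord0 i) => [j ->|->]; last by rewrite tnth0.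
by rewrite tnthS tnth_mktuple.
Qed.

Lemma prepend_tail x w : w 0%N = x -> prepend x (tail w) = w.
Proof. by move=> w0; apply/funext => -[|k]. Qed.

Lemma history0 w : history 0 w = [tuple w 0%N].
Proof. by apply/eq_from_tnth => i; rewrite tnth_mktuple ord1. Qed.

(** The positions reachable in one step, as a sequence of length 2N in which a
    point is repeated when several displacements lead to it.  With this
    multiplicity the next position is a uniform draw from the sequence, and no
    argument needs the displacements to be distinct. *)
Definition successors (eps : R) x (a : 'M[R]_N * 'rV[R]_N) : seq 'rV[R]_N :=
  [seq x + displacement eps a i | i <- enum 'I_N] ++
  [seq x - displacement eps a i | i <- enum 'I_N].

Lemma size_successors eps x a : size (successors eps x a) = (2 * N)%N.
Proof. by rewrite size_cat !size_map -enumT size_enum_ord mul2n addnn. Qed.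

Lemma big_successors (F : 'rV[R]_N -> \bar R) eps x a :
  (\sum_(y <- successors eps x a) F y =
   \sum_(i < N) (F (x + displacement eps a i)%R
                 + F (x - displacement eps a i)%R))%E.
Proof. by rewrite big_cat !big_map -enumT !big_enum /= big_split. Qed.

Lemma transitionE (Omega : set 'rV[R]_N) eps x a B : Omega x ->
  (transition Omega eps x a B =
   ((2 * N)%:R^-1)%:E * \sum_(y <- successors eps x a) \d_y B)%E.
Proof. by move=> Ox; rewrite /transition asboolT// big_successors. Qed.

End trajectories.

Section pushforward_probability.
Context d d' (T : measurableType d) (T' : measurableType d') (R : realType).
Variables (P : probability T R) (phi : T -> T') (mphi : measurable_fun setT phi).

Definition image_law : probability T' R :=
  distribution P (HB.pack phi (isMeasurableFun.Build _ _ _ _ phi mphi)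
    : {mfun T >-> T'}).

Lemma image_lawE A : image_law A = P (phi @^-1` A).
Proof. by []. Qed.

Lemma ge0_integral_image_law D (f : T' -> \bar R) :
  measurable D -> measurable_fun D f -> (forall y, D y -> 0 <= f y)%E ->
  (\int[image_law]_(y in D) f y = \int[P]_(x in phi @^-1` D) (f \o phi) x)%E.
Proof.
move=> mD mf f0; rewrite /image_law /distribution ge0_integral_pushforward//.
by move=> y /set_mem; exact: f0.
Qed.

End pushforward_probability.

Lemma mnormalizeE d (T : measurableType d) (R : realType)
    (mu : {measure set T -> \bar R}) (P : probability T R) (r : R) A :
  mu setT = r%:E -> 0 < r -> mnormalize mu P A = (mu A * r^-1%:E)%E.
Proof. by move=> muT r0; rewrite /mnormalize muT orbF eqe gt_eqF. Qed.

(** * First step analysis *)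

Section first_step.
Context {R : realType} {N : nat}.
Local Notation traj := (g_sigma_algebraType (@cylinders R N)).
Implicit Types (x : 'rV[R]_N) (ys : seq 'rV[R]_N).
Implicit Types (P : probability traj R) (Q : 'rV[R]_N -> probability traj R).

(** P is the law of a trajectory that starts at x, draws its next position
    uniformly from ys and then follows Q y if the draw is y.  Everything about the
    game is obtained from this relation between finitely many laws. *)
Definition first_step x ys Q P := forall A, measurable A ->
  (P A = ((size ys)%:R^-1)%:E * \sum_(y <- ys) Q y (prepend x @^-1` A))%E.

(* ys may have repetitions, so that its branches are indexed by their rank. *)
Let branch x ys Q (k : nat) : {measure set traj -> \bar R} :=
  image_law (Q (nth 0 ys k)) (measurable_prepend x).

Lemma branches_setT x ys Q : msum (branch x ys Q) (size ys) setT = ((size ys)%:R)%:E.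
Proof.
rewrite /msum (eq_bigr (fun=> 1%:E)); last first.
  by move=> k _; exact: (probability_setT (image_law _ _)).
by rewrite sumEFin sumr_const card_ord.
Qed.

Lemma branchesE x ys Q A :
  msum (branch x ys Q) (size ys) A = (\sum_(y <- ys) Q y (prepend x @^-1` A))%E.
Proof. by rewrite /msum (big_nth 0) big_mkord. Qed.

Lemma first_step_ex x ys Q : (0 < size ys)%N -> exists P, first_step x ys Q P.
Proof.
move=> ys0; exists (mnormalize (msum (branch x ys Q) (size ys)) (Q x)) => A mA.
apply: etrans (mnormalizeE _ _ (branches_setT x ys Q) _) _; first by rewrite ltr0n.
by rewrite muleC; congr (_ * _)%E; exact: branchesE.
Qed.

Lemma ge0_integral_first_step x ys Q P (D : set traj) (phi : traj -> \bar R) :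
  first_step x ys Q P -> measurable D -> measurable_fun D phi ->
  (forall w, D w -> 0 <= phi w)%E ->
  (\int[P]_(w in D) phi w = ((size ys)%:R^-1)%:E *
     \sum_(y <- ys) \int[Q y]_(w in prepend x @^-1` D) phi (prepend x w))%E.
Proof.
move=> Pstep mD mphi phi0.
have c0 : 0 <= (size ys)%:R^-1 :> R by rewrite invr_ge0.
rewrite (eq_measure_integral (mscale (NngNum c0) (msum (branch x ys Q) (size ys)))).
  rewrite ge0_integral_mscale//= ge0_integral_measure_sum//.
  rewrite [in RHS](big_nth 0) big_mkord; congr (_ * _)%E.
  by apply: eq_bigr => k _; rewrite ge0_integral_image_law.
move=> A mA _; apply: etrans (Pstep _ mA) _.
by rewrite -branchesE.
Qed.

(** The nonnegative case applied to the positive and negative parts; integrability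
    on each branch excludes a difference of infinities. *)
Lemma integral_first_step x ys Q P (phi : traj -> R) :
  first_step x ys Q P -> measurable_fun setT phi ->
  (forall y, y \in ys -> (Q y).-integrable setT (EFin \o (phi \o prepend x))) ->
  (\int[P]_w (phi w)%:E = ((size ys)%:R^-1)%:E *
     \sum_(y <- ys) \int[Q y]_w (phi (prepend x w))%:E)%E.
Proof.
move=> Pstep mphi iphi.
have mEphi : measurable_fun setT (EFin \o phi) by exact/measurable_EFinP.
pose p y := (\int[Q y]_w (EFin \o (phi \o prepend x))^\+ w)%E.
pose m y := (\int[Q y]_w (EFin \o (phi \o prepend x))^\- w)%E.
have pE y : y \in ys -> p y = (fine (p y))%:E.
  by move=> yys; rewrite fineK//; exact: integrable_pos_fin_num (iphi y yys).
have mE y : y \in ys -> m y = (fine (m y))%:E.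
  by move=> yys; rewrite fineK//; exact: integrable_neg_fin_num (iphi y yys).
have intE y : y \in ys ->
    (\int[Q y]_w (phi (prepend x w))%:E = (fine (p y) - fine (m y))%:E)%E.
  by move=> yys; rewrite EFinB -pE// -mE// -integralE.
rewrite integralE.
rewrite (ge0_integral_first_step Pstep measurableT (measurable_funepos mEphi))//.
rewrite (ge0_integral_first_step Pstep measurableT (measurable_funeneg mEphi))//.
rewrite preimage_setT.
transitivity (((size ys)%:R^-1)%:E * (\sum_(y <- ys) p y) -
              ((size ys)%:R^-1)%:E * (\sum_(y <- ys) m y))%E.
  congr (_ - _)%E; congr (_ * _)%E; apply: eq_bigr => y _;
    by apply: eq_integral => w _; rewrite ?funeposE ?funenegE.
rewrite (eq_big_seq _ pE) (eq_big_seq _ mE).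
rewrite (eq_big_seq _ intE).
by rewrite !sumEFin -!EFinM -EFinB sumrB mulrBr.
Qed.

End first_step.

(** * Almost sure events and conditioning *)

Section almost_sure.
Context d (T : measurableType d) (R : realType).
Implicit Types (P : probability T R) (A D E : set T).

Lemma probability_setC_sure P E : measurable E -> P E = 1%E -> P (~` E) = 0%E.
Proof. by move=> mE PE; rewrite probability_setC// PE subee. Qed.

Lemma probability_setI_sure P A E : measurable A -> measurable E ->
  P E = 1%E -> P (A `&` E) = P A.
Proof.
move=> mA mE PE; have PC := probability_setC_sure mE PE.
rewrite [RHS](_ : _ = P (A `&` E) + P (A `\` E))%E; last first.
  by rewrite addeC -measureDI.
rewrite [X in (_ + X)%E](_ : _ = 0%E) ?adde0//.
apply: (subset_measure0 (mu := P)) PC; [exact: measurableD|exact: measurableC|].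
by move=> t [].
Qed.

(** An event that is decided by u on a sure event E has the probability that
    the Dirac mass at u gives to B, whatever the two spaces. *)
Lemma probability_dirac P E F d' (U : measurableType d') (u : U) (B : set U) :
  P E = 1%E -> measurable E -> measurable F ->
  (forall t, E t -> F t <-> B u) -> P F = \d_u B.
Proof.
move=> PE mE mF EF; rewrite -(probability_setI_sure mF mE PE) diracE.
have [Bu|nBu] := pselect (B u).
  rewrite mem_set// (_ : F `&` E = E)//.
  by apply/seteqP; split => t; [case|move=> Et; split => //; exact/EF].
rewrite memNset// (_ : F `&` E = set0) ?measure0//.
by apply/seteqP; split => t // [Ft Et]; apply: nBu; exact/(EF _ Et).
Qed.

Lemma integral_sure P D E (phi psi : T -> \bar R) :
  measurable D -> measurable E -> P E = 1%E ->
  measurable_fun D phi -> measurable_fun D psi ->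
  (forall t, D t -> E t -> phi t = psi t) ->
  (\int[P]_(t in D) phi t = \int[P]_(t in D) psi t)%E.
Proof.
move=> mD mE PE mphi mpsi eq_phi; apply: ae_eq_integral => //.
exists (~` E); split; first exact: measurableC.
  exact: probability_setC_sure.
move=> t /= neq Et; apply: neq => Dt; exact: eq_phi.
Qed.

(** Conditioning on an event of positive probability, which is all that is needed
    to condition a game on its first position. *)
Lemma conditioning P E (p : R) : measurable E -> P E = p%:E -> 0 < p ->
  exists2 Q : probability T R,
    forall A, Q A = ((p^-1)%:E * P (A `&` E))%E &
    forall D (phi : T -> \bar R), measurable D -> measurable_fun D phi ->
      (forall t, D t -> 0 <= phi t)%E ->
      (\int[Q]_(t in D) phi t = (p^-1)%:E * \int[P]_(t in D `&` E) phi t)%E.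
Proof.
move=> mE PE p0; pose Q := mnormalize (mrestr P mE) P.
have QE A : Q A = ((p^-1)%:E * P (A `&` E))%E.
  rewrite muleC; apply: etrans (mnormalizeE _ _ _ p0) _ => //.
  by rewrite /= /mrestr setTI.
exists Q => //= D phi mD mphi phi0.
have mDE : measurable (D `&` E) by exact: measurableI.
have c0 : 0 <= p^-1 by rewrite invr_ge0 ltW.
have mE' : measurable (~` E) by exact: measurableC.
(* Q does not charge ~` E, and on subsets of E it is a multiple of P *)
rewrite (ge0_negligible_integral (N := ~` E))//; last first.
  by apply: etrans (QE _) _; rewrite setICl measure0 mule0.
rewrite setDE setCK (eq_measure_integral (mscale (NngNum c0) P)).
  rewrite ge0_integral_mscale//; first exact: measurable_funS mphi.
  by move=> t [/phi0].
move=> A mA ADE; apply: etrans (QE _) _; rewrite setIidl//.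
by move=> t /ADE[].
Qed.

Lemma measure_fibers P A (I : choiceType) (X : T -> I) (s : seq I) :
  measurable A -> (forall i, measurable (X @^-1` [set i])) -> uniq s ->
  (\sum_(i <- s) P (A `&` X @^-1` [set i]) = P (A `&` X @^-1` [set` s]))%E.
Proof.
move=> mA mX; elim: s => [|i s ih] /=.
  move=> _; rewrite big_nil (_ : _ `&` _ = set0) ?measure0//.
  by apply/seteqP; split => t //; case.
move=> /andP[iNs us]; rewrite big_cons ih// -measureU.
- congr (P _); apply/seteqP; split=> t /=.
    by case=> -[At /= Xt]; split => //=; rewrite in_cons ?Xt ?eqxx// orbT.
  by rewrite in_cons => -[At /orP[/eqP|]]; [left|right].
- exact: measurableI.
- apply: measurableI => //.
  rewrite (_ : X @^-1` _ = \bigcup_(j in [set` s]) X @^-1` [set j]).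
    by apply: fin_bigcup_measurable => // j _.
  by apply/seteqP; split=> [t /= Xt|t [j /= js Xt]]; [exists (X t)|rewrite Xt].
- apply/seteqP; split => t //= -[[_ Xt] [_]]; rewrite Xt => js.
  by rewrite js in iNs.
Qed.

End almost_sure.

(** * Laws of games through their first step *)

Lemma average_cst (R : realType) (I : Type) (s : seq I) (r : R) :
  (0 < size s)%N -> (((size s)%:R^-1)%:E * \sum_(i <- s) r%:E = r%:E)%E.
Proof.
move=> s0; rewrite sumEFin big_const_seq count_predT iter_addr_0 -EFinM.
by rewrite -(mulr_natl r) mulKf// pnatr_eq0 -lt0n.
Qed.

Section game_laws.
Context {R : realType} {N : nat}.
Local Notation traj := (g_sigma_algebraType (@cylinders R N)).
Implicit Types (x y : 'rV[R]_N) (ys : seq 'rV[R]_N) (S : strategy R N).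
Implicit Types (P : probability traj R) (Q : 'rV[R]_N -> probability traj R).
Variables (Omega : set 'rV[R]_N) (eps : R).
Hypothesis mOmega : measurable Omega.

Definition measurable_strategy S :=
  forall n, measurable_fun [set: n.+1.-tuple 'rV[R]_N] (S n).

Definition starts_at x : set traj := [set w | w 0%N = x].

Lemma measurable_preimage_position k (B : set 'rV[R]_N) : measurable B ->
  measurable [set w : traj | B (w k)].
Proof.
by move=> mB; have := measurable_position k measurableT mB; rewrite setTI.
Qed.

Lemma measurable_preimage_history n (A : set (n.+1.-tuple 'rV[R]_N)) :
  measurable A -> measurable [set w : traj | A (history n w)].
Proof.
by move=> mA; have := measurable_history measurableT mA; rewrite setTI.
Qed.

Lemma measurable_starts_at x : measurable (starts_at x).
Proof.
exact: (measurable_preimage_position 0 (measurable_set1_mx x)).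
Qed.

Lemma transition_ge0 x a B : (0 <= transition Omega eps x a B)%E.
Proof.
rewrite /transition; case: ifP => // _; apply: mule_ge0.
  by rewrite lee_fin invr_ge0.
by apply: sume_ge0 => i _; apply: adde_ge0.
Qed.

Definition next_position_transition S n B (w : traj) : \bar R :=
  transition Omega eps (w n) (S n (history n w)) B.

(** The atoms of the transition are affine in the position and the move, both of
    which are measurable functions of the history; the transition kernel is
    therefore measurable along any measurable strategy. *)
Lemma measurable_next_position_transition S n B :
  measurable_strategy S -> measurable B ->
  measurable_fun setT (next_position_transition S n B).
Proof.
move=> mS mB; pose a (w : traj) := S n (history n w).
have ma : measurable_fun setT a.
  by apply: (measurableT_comp (mS n)); exact: measurable_history.
have mpos j : measurable_fun setT (fun w : traj => w n 0 j).
  apply: (measurableT_comp (measurable_coord 0 j)); exact: measurable_position.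
have mdispl i j : measurable_fun setT (fun w : traj => displacement eps (a w) i 0 j).
  rewrite (_ : (fun _ => _) = fun w => eps * (a w).2 0 i * (a w).1 i j); last first.
    by apply/funext => w; rewrite !mxE.
  apply: measurable_funM; first apply: measurable_funM => //.
  - apply: (measurableT_comp (measurable_coord 0 i)).
    exact: (measurableT_comp measurable_snd).
  - apply: (measurableT_comp (measurable_coord i j)).
    exact: (measurableT_comp measurable_fst).
rewrite /next_position_transition /transition.
apply: measurable_fun_ifT.
- apply: (@measurable_fun_bool _ _ _ _ true).
  rewrite (_ : _ @^-1` _ = [set w : traj | Omega (w n)]).
    by rewrite setTI; exact: measurable_preimage_position.
  by apply/seteqP; split => w /=; [move/asboolP|move=> ?; apply/asboolP].
- apply: emeasurable_funM => //; apply: emeasurable_sum => i.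
  apply: emeasurable_funD.
  + apply: (measurableT_comp (measurable_fun_dirac mB)).
    apply: measurable_fun_mx => k j.
    rewrite (_ : (fun _ => _) = fun w : traj => w n 0 j + displacement eps (a w) i 0 j).
      exact: measurable_funD.
    by apply/funext => w; rewrite mxE ord1.
  + apply: (measurableT_comp (measurable_fun_dirac mB)).
    apply: measurable_fun_mx => k j.
    rewrite (_ : (fun _ => _) = fun w : traj => w n 0 j - displacement eps (a w) i 0 j).
      exact: measurable_funB.
    by apply/funext => w; rewrite !mxE ord1.
- apply: (measurableT_comp (measurable_fun_dirac mB)).
  exact: measurable_position.
Qed.

(** The transition property at one fixed time, isolated to allow induction on
    time. *)
Definition step_law S P n := forall A B, measurable A -> measurable B ->
  P [set w : traj | A (history n w) /\ B (w n.+1)] =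
  (\int[P]_(w in [set w : traj | A (history n w)])
     next_position_transition S n B w)%E.

Lemma first_step_starts_at x ys Q P : (0 < size ys)%N ->
  first_step x ys Q P -> P (starts_at x) = 1%E.
Proof.
move=> ys0 Pstep; rewrite Pstep; last exact: measurable_starts_at.
rewrite (eq_bigr (fun=> 1%E)); last first.
  move=> y _; rewrite (_ : _ @^-1` _ = setT) ?probability_setT//.
  by apply/seteqP; split.
exact: average_cst.
Qed.

(** At time 0 the history is almost surely the constant x, so that both sides of
    the transition property are explicit.  The transition from x is only assumed
    to be a uniform draw from ys: this covers a position outside Omega, where ys
    repeats x. *)
Lemma step_law_first S x ys Q P : (0 < size ys)%N -> measurable_strategy S ->
  (forall B, transition Omega eps x (S 0%N [tuple x]) B =
     ((size ys)%:R^-1)%:E * \sum_(y <- ys) \d_y B)%E ->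
  (forall y, y \in ys -> Q y (starts_at y) = 1%E) ->
  first_step x ys Q P -> step_law S P 0.
Proof.
move=> ys0 mS ysE Qy Pstep A B mA mB.
have Px := first_step_starts_at ys0 Pstep.
rewrite (integral_sure (P := P) (E := starts_at x)
    (psi := cst (transition Omega eps x (S 0%N [tuple x]) B))).
- rewrite integral_cst; last exact: measurable_preimage_history.
  rewrite Pstep; last first.
    apply: measurableI; first exact: measurable_preimage_history.
    exact: measurable_preimage_position.
  have PA : P [set w | A (history 0 w)] = \d_[tuple x] A.
    apply: (probability_dirac Px (measurable_starts_at x)).
      exact: measurable_preimage_history.
    by move=> w w0 /=; rewrite history0 w0.
  transitivity (transition Omega eps x (S 0%N [tuple x]) B * \d_[tuple x] A)%E;
    last by congr (_ * _)%E; exact/esym.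
  rewrite ysE -muleA; congr (_ * _)%E.
  rewrite ge0_sume_distrl//; apply: eq_big_seq => y yys.
  have [Ax|nAx] := pselect (A [tuple x]); last first.
    rewrite [\d_[tuple x] A]diracE memNset// mule0 (_ : _ @^-1` _ = set0) ?measure0//.
    by apply/seteqP; split => w //=; rewrite history0 => -[].
  rewrite [\d_[tuple x] A]diracE mem_set// mule1.
  apply: (probability_dirac (Qy _ yys) (measurable_starts_at y)).
    rewrite (_ : _ @^-1` _ = [set w : traj | B (w 0%N)]).
      exact: measurable_preimage_position.
    by apply/seteqP; split => w /=; rewrite history0; [case|].
  by move=> w w0 /=; rewrite history0 /= w0; split => [[]|].
- exact: measurable_preimage_history.
- exact: measurable_starts_at.
- exact: Px.
- apply: measurable_funTS; exact: measurable_next_position_transition.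
- exact: measurable_cst.
- by move=> w _ w0; rewrite /next_position_transition history0 w0.
Qed.

(** On the branch y the trajectory almost surely starts at y, and there the
    strategy S after x plays like S' y: the transition property of the mixture
    at time n+1 is the average of those of the branches at time n. *)
Lemma step_law_later S x ys (S' : 'rV[R]_N -> strategy R N) Q P n :
  measurable_strategy S -> (forall y, measurable_strategy (S' y)) ->
  (forall y h, y \in ys -> thead h = y ->
    S n.+1 (cons_tuple x h) = S' y n h) ->
  (forall y, y \in ys -> Q y (starts_at y) = 1%E) ->
  (forall y, y \in ys -> step_law (S' y) (Q y) n) ->
  first_step x ys Q P -> step_law S P n.+1.
Proof.
move=> mS mS' SS' Qy Qstep Pstep A B mA mB.
rewrite Pstep; last first.
  apply: measurableI; first exact: measurable_preimage_history.
  exact: measurable_preimage_position.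
rewrite (ge0_integral_first_step Pstep); first last.
- by move=> w _; exact: transition_ge0.
- apply: measurable_funTS; exact: measurable_next_position_transition.
- exact: measurable_preimage_history.
congr (_ * _)%E; rewrite big_seq [RHS]big_seq; apply: eq_bigr => y yys.
pose A' : set (n.+1.-tuple 'rV[R]_N) := [set h | A (cons_tuple x h)].
have mA' : measurable A'.
  rewrite -[A']setTI.
  exact: (measurable_cons (measurable_cst x) (@measurable_id _ _ setT)).
have E1 : prepend x @^-1` [set w | A (history n.+1 w) /\ B (w n.+2)] =
   [set w | A' (history n w) /\ B (w n.+1)].
  by apply/seteqP; split => w /=; rewrite history_prepend.
have E2 : prepend x @^-1` [set w | A (history n.+1 w)] =
   [set w | A' (history n w)].
  by apply/seteqP; split => w /=; rewrite history_prepend.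
rewrite E1 E2; apply: etrans (Qstep _ yys _ _ mA' mB) _.
apply: (integral_sure (P := Q y) (E := starts_at y)).
- exact: measurable_preimage_history.
- exact: measurable_starts_at.
- exact: Qy.
- apply: measurable_funTS; exact: measurable_next_position_transition.
- apply: measurable_funTS.
  apply: (measurableT_comp (measurable_next_position_transition n.+1 mS mB)).
  exact: measurable_prepend.
move=> w _ w0; rewrite /next_position_transition history_prepend (SS' y)//.
by rewrite /thead tnth_mktuple.
Qed.

End game_laws.

(** * Conditioning a game on its first move *)

Section decomposition.
Context {R : realType} {N : nat}.
Local Notation traj := (g_sigma_algebraType (@cylinders R N)).
Variables (Omega : set 'rV[R]_N) (eps : R).
Hypotheses (mOmega : measurable Omega) (N_gt0 : (0 < N)%N).

Definition continuation (S : strategy R N) (x : 'rV[R]_N) : strategy R N :=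
  fun n h => S n.+1 (cons_tuple x h).

Lemma measurable_continuation S x :
  measurable_strategy S -> measurable_strategy (continuation S x).
Proof.
move=> mS n; apply: (measurableT_comp (mS n.+1)).
exact: (measurable_cons (measurable_cst x) (@measurable_id _ _ setT)).
Qed.

Lemma borel_continuation lam Lam S x :
  borel_strategy lam Lam S -> borel_strategy lam Lam (continuation S x).
Proof.
move=> bS n; split; last by move=> h; apply: (bS n.+1).2.
by apply: measurable_continuation => k; have [] := bS k.
Qed.

Section from_inside.
Variables (S : strategy R N) (x : 'rV[R]_N) (P : probability traj R).
Hypotheses (mS : measurable_strategy S) (Ox : Omega x).
Hypothesis gameP : game_measure Omega eps S x P.
Let ys := successors eps x (@S 0%N [tuple x]).
Let Px : P (starts_at x) = 1%E. Proof. by case: gameP. Qed.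

Let first_position y : set traj := [set w | w 1%N = y].

Let measurable_first_position y : measurable (first_position y).
Proof. exact: (measurable_preimage_position 1 (measurable_set1_mx y)). Qed.

Let ys_gt0 : (0 < size ys)%N.
Proof. by rewrite size_successors muln_gt0. Qed.

(** The transition property at time 0 with no constraint on the history. *)
Lemma law_of_first_position B : measurable B ->
  (P [set w | B (w 1%N)] =
     ((size ys)%:R^-1)%:E * \sum_(y <- ys) \d_y B)%E.
Proof.
move=> mB; have [_ /(_ 0%N setT B measurableT mB)] := gameP.
rewrite (_ : [set w | _ /\ _] = [set w : traj | B (w 1%N)]); last first.
  by apply/seteqP; split => w /=; [case|].
move=> ->; rewrite size_successors -(transitionE eps _ B Ox).
rewrite (_ : [set w | _] = setT); last by apply/seteqP; split.
rewrite (integral_sure (P := P) (E := starts_at x)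
    (psi := cst (transition Omega eps x (@S 0%N [tuple x]) B))).
- by rewrite integral_cst// [X in (_ * X)%E](probability_setT P) mule1.
- exact: measurableT.
- exact: measurable_starts_at.
- exact: Px.
- apply: measurable_funTS.
  exact: (measurable_next_position_transition eps mOmega 0 mS mB).
- exact: measurable_cst.
- by move=> w _ w0; rewrite history0 w0.
Qed.

(* Coinciding displacements make y more likely, hence the multiplicity. *)
Let p y : R := (size ys)%:R^-1 * (count_mem y ys)%:R.

Let p_gt0 y : y \in ys -> 0 < p y.
Proof.
by move=> yys; rewrite mulr_gt0// ?invr_gt0 ltr0n// -has_count has_pred1.
Qed.

Let probability_first_position y : P (first_position y) = (p y)%:E.
Proof.
rewrite (law_of_first_position (measurable_set1_mx y)) EFinM; congr (_ * _)%E.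
rewrite (eq_bigr (fun z => ((z == y)%:R)%:E)); last first.
  move=> z _; rewrite diracE; congr ((nat_of_bool _)%:R%:E).
  by apply/idP/eqP => [/set_mem//|->]; exact: mem_set.
rewrite sumEFin -sum1_count natr_sum big_mkcond [in RHS]big_mkcond /=.
by congr EFin; apply: eq_bigr => z _; case: eqP.
Qed.

Let measurable_ys : measurable [set` ys].
Proof.
rewrite (_ : [set` ys] = \bigcup_(y in [set` ys]) [set y]); last first.
  by apply/seteqP; split => [y|y [z zys ->]//]; exists y.
by apply: fin_bigcup_measurable => // y _; exact: measurable_set1_mx.
Qed.

Let first_positions_sure : P [set w | w 1%N \in ys] = 1%E.
Proof.
apply: etrans (law_of_first_position measurable_ys) _.
rewrite big_seq (eq_bigr (fun=> 1%E)); last by move=> y yys; rewrite diracE mem_set.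
by rewrite -big_seq average_cst.
Qed.

(** The Markov property at time 1.  Only finitely many positions are reachable in
    one step, each with positive probability, so that the law of the
    continuation is an elementary conditional probability.  Summed over the
    distinct reachable points these laws rebuild P; the multiplicities turn the
    weighted sum into the plain average of first_step. *)
Lemma game_measure_first_step :
  exists2 Q, first_step x ys Q P &
    forall y, y \in ys -> game_measure Omega eps (continuation S x) y (Q y).
Proof.
have /choice[Q QP] : forall y, exists Qy : probability traj R, y \in ys ->
    (forall A, Qy A = ((p y)^-1)%:E * P (A `&` first_position y))%E /\
    forall D (phi : traj -> \bar R), measurable D -> measurable_fun D phi ->
      (forall t, D t -> 0 <= phi t)%E ->
      (\int[Qy]_(t in D) phi t =
         ((p y)^-1)%:E * \int[P]_(t in D `&` first_position y) phi t)%E.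
  move=> y; have [yys|_] := boolP (y \in ys); last by exists P.
  have [Qy Q1 Q2] := conditioning (measurable_first_position y)
    (probability_first_position y) (p_gt0 yys).
  by exists Qy.
have m_ys : measurable [set w : traj | w 1%N \in ys].
  exact: (measurable_preimage_position 1 measurable_ys).
have mSx : measurable (starts_at x) := measurable_starts_at x.
have mtail (C : set traj) : measurable C -> measurable (tail @^-1` C).
  by move=> mC; rewrite -[X in measurable X]setTI; exact: measurable_tail.
have mprepend (C : set traj) : measurable C -> measurable (prepend x @^-1` C).
  by move=> mC; rewrite -[X in measurable X]setTI; exact: measurable_prepend.
exists (fun y => image_law (Q y) measurable_tail).
  move=> A mA; have mAx : measurable (A `&` starts_at x) by exact: measurableI.
  have -> : P A = (\sum_(y <- undup ys) P ((A `&` starts_at x) `&` first_position y))%E.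
    rewrite (measure_fibers P mAx measurable_first_position (undup_uniq ys)).
    rewrite (_ : _ @^-1` _ = [set w : traj | w 1%N \in ys]); last first.
      by apply/seteqP; split => w /=; rewrite mem_undup.
    rewrite (probability_setI_sure mAx m_ys first_positions_sure).
    by rewrite probability_setI_sure.
  rewrite -(big_undup_iterop_count _ ys) ge0_sume_distrr; last first.
    move=> y _; rewrite -/(_ *+ _)%E -mule_natl.
    by apply: mule_ge0 => //; exact: measure_ge0.
  apply: eq_big_seq => y; rewrite mem_undup => yys.
  rewrite -/(_ *+ _)%E -mule_natl muleA -EFinM.
  have [Q1 _] := QP y yys.
  apply: etrans _ (congr1 (fun t => (_ * t)%E) (esym (Q1 _))).
  rewrite muleA -EFinM mulfV ?gt_eqF ?p_gt0// mul1e.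
  rewrite -[RHS](probability_setI_sure _ mSx Px); last first.
    by apply: measurableI => //; exact: (mtail _ (mprepend _ mA)).
  congr (P _); apply/seteqP; split => w /=.
    by move=> [[Aw w0] w1]; rewrite prepend_tail.
  by move=> [[Aw w1] w0]; rewrite prepend_tail in Aw.
move=> y yys; have [Q1 Q2] := QP y yys; split.
  apply: etrans (Q1 _) _; rewrite (_ : _ `&` _ = first_position y).
    by rewrite probability_first_position -EFinM mulVf// gt_eqF// p_gt0.
  by apply/seteqP; split => w //; case.
move=> n A B mA mB; apply: etrans (Q1 _) _.
(* the event A of the continuation from y, as an event of the whole history *)
pose A' : set (n.+2.-tuple 'rV[R]_N) := [set h : n.+2.-tuple 'rV[R]_N |
  A [tuple of behead h] /\ tnth h (lift ord0 ord0) = y].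
have mA' : measurable A'.
  apply: measurableI.
    by rewrite -[X in measurable X]setTI; exact: measurable_behead.
  rewrite -[X in measurable X]setTI.
  have mt := @measurable_tnth _ 'rV[R]_N n.+2 (lift ord0 ord0).
  exact: (mt measurableT _ (measurable_set1_mx y)).
have A'E w : A' (history n.+1 w) <-> A (history n (tail w)) /\ w 1%N = y.
  rewrite /A' /= tnth_mktuple /=.
  have -> // : [tuple of behead (history n.+1 w)] = history n (tail w)
    :> n.+1.-tuple 'rV[R]_N.
  apply/eq_from_tnth => i; rewrite tnth_behead !tnth_mktuple /tail.
  by rewrite /= inordK// ltnS ltn_ord.
have Pn := (gameP.2 n.+1 A' B mA' mB).
rewrite (_ : _ `&` _ = [set w : traj | A' (history n.+1 w) /\ B (w n.+2)]); last first.
  apply/seteqP; split => w /=.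
    by move=> [[? ?] ?]; split => //; exact/A'E.
  by move=> [/A'E[? ?] ?].
apply: etrans (congr1 _ Pn) _.
have mhA := measurable_preimage_history mA.
have mtr := measurable_next_position_transition eps mOmega n
  (measurable_continuation x mS) mB.
rewrite [RHS]ge0_integral_image_law; last 3 first.
- exact: mhA.
- exact: measurable_funTS mtr.
- by move=> w _; exact: transition_ge0.
have mtrtail := measurableT_comp mtr measurable_tail.
rewrite [RHS]Q2; last 3 first.
- exact: mtail.
- exact: measurable_funTS mtrtail.
- by move=> w _; exact: transition_ge0.
congr (_ * _)%E.
rewrite (_ : [set w | A' _] =
  (tail @^-1` [set w | A (history n w)]) `&` first_position y); last first.
  by apply/seteqP; split => w /=; move/A'E.
apply: (integral_sure (P := P) (E := starts_at x)).
- by apply: measurableI => //; exact: mtail.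
- exact: measurable_starts_at.
- exact: Px.
- apply: measurable_funTS.
  exact: (measurable_next_position_transition eps mOmega n.+1 mS mB).
- exact: measurable_funTS mtrtail.
move=> w _ w0 /=; rewrite /next_position_transition /continuation.
by rewrite -history_prepend prepend_tail.
Qed.

End from_inside.
End decomposition.

(** * A random walk coded by the digits of a uniform variable *)

Section uniform_coding.
Context {R : realType}.
Variable M : nat.
Hypothesis M_gt0 : (0 < M)%N.
Local Notation mu := (@lebesgue_measure R).

Let M0 : 0 < M%:R :> R. Proof. by rewrite ltr0n. Qed.

Definition subdivision (k : nat) (s : R) : R := (s + k%:R) / M%:R.

Lemma measurable_subdivision k : measurable_fun setT (subdivision k).
Proof. by apply: measurable_funM => //; exact: measurable_funD. Qed.

(** Both sides are measures that agree on half-open intervals. *)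
Lemma lebesgue_measure_affine (k : nat) (E : set R) : measurable E ->
  mu E = ((M%:R^-1)%:E * mu (subdivision k @^-1` E))%E.
Proof.
move=> mE; have c0 : 0 <= M%:R^-1 :> R by rewrite invr_ge0.
pose nu : {measure set (measurableTypeR R) -> \bar R} :=
  mscale (NngNum c0) (pushforward mu
    (subdivision k : measurableTypeR R -> measurableTypeR R)).
have nuE := lebesgue_measure_unique (mu := nu (measurable_subdivision k)).
apply: etrans (nuE _ _ mE) _ => //.
move=> _ [[a b] /= _ <-].
change (mu `]a, b]%classic = (M%:R^-1)%:E * mu (subdivision k @^-1` `]a, b]%classic))%E.
rewrite (_ : _ @^-1` _ = `](M%:R * a - k%:R), (M%:R * b - k%:R)]%classic); last first.
  by apply/seteqP; split => s /=; rewrite !in_itv /= /subdivision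
    ltr_pdivlMr// ler_pdivrMr// ltrBlDr lerBrDr ![_ * M%:R]mulrC.
have len (u v : R) : mu `]u, v]%classic =
      if u < v then (v - u)%:E else 0%E.
  by have := lebesgue_measure_itv `]u, v]; rewrite /= lte_fin.
apply: etrans (len a b) _.
apply: etrans _ (congr1 (fun t => (_ * t)%E) (esym (len _ _))).
rewrite ltrD2r ltr_pM2l//.
case: ifP => _; last by rewrite mule0.
rewrite -EFinM; congr EFin.
by field; rewrite gt_eqF.
Qed.

Definition unit_itv : set R := `[0, 1[%classic.

Lemma measurable_unit_itv : measurable unit_itv.
Proof. exact: measurable_itv. Qed.

Definition leading_digit (t : R) := Num.truncn (M%:R * t).

Lemma measurable_leading_digit k : measurable (leading_digit @^-1` [set k]).
Proof.
have mgt j : measurable (leading_digit @^-1` [set i | (j < i)%N]).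
  rewrite (_ : _ @^-1` _ = `[j.+1%:R / M%:R, +oo[%classic); first exact: measurable_itv.
  apply/seteqP; split => t /=; rewrite in_itv /= andbT /leading_digit;
    by rewrite truncn_gt_nat ler_pdivrMr// mulrC.
have mge j : measurable (leading_digit @^-1` [set i | (j <= i)%N]).
  case: j => [|j]; last exact: mgt.
  by rewrite (_ : _ @^-1` _ = setT)//; apply/seteqP; split.
rewrite (_ : _ @^-1` _ = leading_digit @^-1` [set i | (k <= i)%N] `\`
    leading_digit @^-1` [set i | (k < i)%N]).
  exact: measurableD.
apply/seteqP; split => t /=; first by move=> ->; split => //; rewrite ltnn.
by move=> [ge /negP]; rewrite -leqNgt => le; apply/eqP; rewrite eqn_leq le.
Qed.

Let piece (k : nat) : set R := `[k%:R / M%:R, k.+1%:R / M%:R[%classic.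

Let pieceP k s : piece k s <-> k%:R <= M%:R * s < k.+1%:R.
Proof. by rewrite /piece /= in_itv /= ler_pdivrMr// ltr_pdivlMr// mulrC. Qed.

Let leading_digit_piece k s : piece k s -> leading_digit s = k.
Proof. by move=> /pieceP; exact: truncn_def. Qed.

Let piece_subdivision k s : piece k (subdivision k s) <-> unit_itv s.
Proof.
rewrite /piece /unit_itv /= !in_itv /= /subdivision.
rewrite ler_pM2r ?invr_gt0// ltr_pM2r ?invr_gt0//.
by rewrite -natr1 lerDr addrC ltrD2l.
Qed.

Lemma leading_digit_subdivision k s :
  unit_itv s -> leading_digit (subdivision k s) = k.
Proof. by move=> s01; apply/leading_digit_piece/piece_subdivision. Qed.

Let cover_unit_itv C :
  C `&` unit_itv = \big[setU/set0]_(k < M) (C `&` piece k).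
Proof.
rewrite -(bigcup_mkord M (fun k => C `&` piece k)); apply/seteqP; split=> s /=.
  rewrite /unit_itv /= in_itv /= => -[Cs /andP[s0 s1]].
  have Ms0 : 0 <= M%:R * s by rewrite mulr_ge0.
  exists (leading_digit s) => /=.
    by rewrite truncn_lt_nat// -[ltRHS]mulr1 ltr_pM2l.
  by split => //; apply/pieceP; exact: truncn_itv.
move=> [k /= kM [Cs ks]]; split=> //; move: ks => /pieceP/andP[ks sk].
rewrite /unit_itv /= in_itv /=; apply/andP; split.
  by rewrite -(pmulr_rge0 _ M0) (le_trans _ ks).
by rewrite -(ltr_pM2l M0) mulr1 (lt_le_trans sk)// ler_nat.
Qed.

(** The uniform law of [0, 1[ in base M: conditionally on its leading digit k, a
    uniform variable is (k + s) / M with s uniform. *)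
Lemma self_similar_ex : exists2 U : probability (measurableTypeR R) R,
  U unit_itv = 1%E &
  forall C, measurable C -> U C = ((M%:R^-1)%:E * \sum_(k < M)
     U (subdivision k @^-1` C))%E.
Proof.
have len1 : mu unit_itv = 1%E.
  by have := lebesgue_measure_itv `[(0:R), (1:R)[; rewrite /= lte_fin ltr01 sube0.
have [U UE] : exists U : probability (measurableTypeR R) R,
    forall C, U C = mu (C `&` unit_itv).
  exists (mnormalize (mrestr mu measurable_unit_itv)
    (@dirac _ (measurableTypeR R) 0 R)) => C.
  apply: etrans (mnormalizeE _ _ (r := 1) _ ltr01) _; last by rewrite invr1 mule1.
  by rewrite /= /mrestr setTI.
exists U; first by rewrite UE setIid.
move=> C mC; rewrite UE.
have mpiece k : measurable (piece k : set (measurableTypeR R)).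
  exact: (measurable_itv `[k%:R / M%:R, k.+1%:R / M%:R[).
have mCpiece k : measurable (C `&` piece k : set (measurableTypeR R)).
  exact: measurableI mC (mpiece k).
have tCpiece : trivIset setT (fun k => C `&` piece k).
  move=> i j _ _ [s [[_ si] [_ sj]]].
  by rewrite -(leading_digit_piece si) -(leading_digit_piece sj).
have additive_mu := @measure_bigsetU _ R (measurableTypeR R) mu.
rewrite cover_unit_itv.
apply: etrans (additive_mu _ mCpiece tCpiece M) _.
rewrite ge0_sume_distrr//; apply: eq_bigr => k _; rewrite UE.
apply: etrans (lebesgue_measure_affine k (mCpiece k)) _.
congr (_ * mu _)%E; rewrite preimage_setI; congr (_ `&` _).
by apply/seteqP; split => s; [exact: (piece_subdivision k s).1|
  exact: (piece_subdivision k s).2].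
Qed.

End uniform_coding.

Section markov_chain.
Context {R : realType} {N : nat}.
Local Notation traj := (g_sigma_algebraType (@cylinders R N)).
Variables (M : nat) (next : 'rV[R]_N -> seq 'rV[R]_N).
Hypotheses (M_gt0 : (0 < M)%N) (size_next : forall x, size (next x) = M).

(* The state is a position with a real number whose digits in base M are the
   draws still to be made; a step consumes the leading digit. *)
Let step (z : 'rV[R]_N * R) :=
  let k := leading_digit M z.2 in (nth 0 (next z.1) k, M%:R * z.2 - k%:R).

Let walk x t : traj := fun n => (iter n step (x, t)).1.

Let walkE x t :
  walk x t = prepend x
    (walk (nth 0 (next x) (leading_digit M t)) (M%:R * t - (leading_digit M t)%:R)).
Proof. by apply/funext => -[//|n]; rewrite /walk iterSr. Qed.

Let walk_subdivision x k s : unit_itv s ->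
  walk x (subdivision M k s) = prepend x (walk (nth 0 (next x) k) s).
Proof.
move=> s01; rewrite walkE leading_digit_subdivision//.
rewrite (_ : M%:R * _ - _ = s)//.
by rewrite /subdivision mulrC divfK ?gt_eqF ?ltr0n// -addrA subrr addr0.
Qed.

Lemma measurable_fun_switch d d' (T : measurableType d) (T' : measurableType d')
    (c : T -> nat) (F : nat -> T -> T') :
  (forall k, measurable (c @^-1` [set k])) ->
  (forall k, measurable_fun setT (F k)) -> measurable_fun setT (fun t => F (c t) t).
Proof.
move=> mc mF; rewrite (_ : setT = \bigcup_k (c @^-1` [set k])); last first.
  by apply/seteqP; split => // t _; exists (c t).
apply/measurable_fun_bigcup => // k.
apply: (eq_measurable_fun (F k)); last exact: measurable_funTS.
by move=> t /set_mem /= ->.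
Qed.

Let measurable_walk x : measurable_fun setT (walk x).
Proof.
apply: measurable_fun_traj => n; elim: n x => [|n ih] x; first exact: measurable_cst.
pose F k t := walk (nth 0 (next x) k) (M%:R * t - k%:R) n.
rewrite (_ : (fun _ => _) = fun t => F (leading_digit M t) t); last first.
  by apply/funext => t; rewrite walkE.
apply: (measurable_fun_switch (c := leading_digit M)) => k.
  exact: measurable_leading_digit.
by apply: (measurableT_comp (ih _)); apply: measurable_funB.
Qed.

(** Existence of a Markov chain with M equally likely transitions: all
    walks are driven by the digits of one
    uniform variable, and the self-similarity of its law is the first step
    relation. *)
Lemma markov_chain_ex :
  exists P : 'rV[R]_N -> probability traj R,
    forall x, first_step x (next x) P (P x).
Proof.
have [U U1 Uself] := @self_similar_ex R M M_gt0.
exists (fun x => image_law U (measurable_walk x)) => x A mA.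
rewrite size_next (big_nth 0) big_mkord size_next.
have mW : measurable (walk x @^-1` A).
  by rewrite -[X in measurable X]setTI; exact: measurable_walk.
rewrite image_lawE Uself//; congr (_ * _)%E; apply: eq_bigr => k _.
have mU : measurable (unit_itv : set (measurableTypeR R)) := measurable_unit_itv.
rewrite -[LHS](probability_setI_sure _ mU U1); last first.
  by rewrite -[X in measurable X]setTI; exact: measurable_subdivision.
rewrite -[RHS](probability_setI_sure _ mU U1); last first.
  rewrite -[X in measurable X]setTI; apply: measurable_walk => //.
  by rewrite -[X in measurable X]setTI; exact: measurable_prepend.
congr (U _); apply/seteqP; split => s [].
  by rewrite /preimage /= => As s01; rewrite -walk_subdivision.
by rewrite /preimage /= => As s01; rewrite walk_subdivision.
Qed.

End markov_chain.

(** * Construction of games *)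

Section game_construction.
Context {R : realType} {N : nat}.
Local Notation traj := (g_sigma_algebraType (@cylinders R N)).
Local Notation move := ('M[R]_N * 'rV[R]_N)%type.
Variables (Omega : set 'rV[R]_N) (lam Lam eps : R).
Hypotheses (mOmega : measurable Omega) (N_gt0 : (0 < N)%N).

Let M_gt0 : (0 < 2 * N)%N. Proof. by rewrite muln_gt0. Qed.

Definition constant_strategy (a : move) : strategy R N := fun _ _ => a.

Lemma borel_measurable_strategy (S : strategy R N) :
  borel_strategy lam Lam S -> measurable_strategy S.
Proof. by move=> bS n; have [] := bS n. Qed.

(** Needed to bound the value from below: the supremum is over a nonempty set. *)
Lemma constant_game_measure_ex a x :
  exists P : probability traj R, game_measure Omega eps (constant_strategy a) x P.
Proof.
(* outside Omega the walk stays put, written as a draw among 2N copies of x *)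
pose next x := if `[< Omega x >] then successors eps x a else nseq (2 * N) x.
have size_next y : size (next y) = (2 * N)%N.
  by rewrite /next; case: ifP => _; rewrite ?size_successors ?size_nseq.
have [P Pstep] := markov_chain_ex M_gt0 size_next.
have Pstart y : P y (starts_at y) = 1%E.
  by apply: first_step_starts_at (Pstep y); rewrite size_next.
have mS : measurable_strategy (constant_strategy a) by move=> n; exact: measurable_cst.
suff Plaw n y : step_law Omega eps (constant_strategy a) (P y) n.
  by exists (P x); split => // n A B mA mB; exact: Plaw.
elim: n y => [|n ih] y.
  apply: (step_law_first mOmega _ mS _ _ (Pstep y)) => //; first by rewrite size_next.
  move=> B; rewrite size_next /next; case: asboolP => Oy; first exact: transitionE.
  rewrite /transition asboolF// diracE.
  rewrite (eq_big_seq (fun=> ((y \in B)%:R)%:E)); last first.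
    by move=> z; rewrite mem_nseq => /andP[_ /eqP ->]; rewrite diracE.
  by have := @average_cst R _ (nseq (2 * N) y) (y \in B)%:R; rewrite size_nseq => ->.
exact: (step_law_later mOmega mS (S' := fun=> constant_strategy a) _ _ _ _ (Pstep y)).
Qed.

(** Play a first, then the strategy S' y if the next position is y.  As only the
    finitely many positions of ys can occur, the case distinction is a finite
    one: the spliced strategy is Borel although S' may depend on y in a
    non-measurable way, and no measurable selection is needed. *)
Definition splice (a : move) (ys : seq 'rV[R]_N) (S' : 'rV[R]_N -> strategy R N) :
    strategy R N := fun n =>
  if n is m.+1 then fun h : m.+2.-tuple 'rV[R]_N =>
    foldr (fun y b => if thead [tuple of behead h] == y
                      then S' y m [tuple of behead h] else b) a ys
  else fun=> a.

Lemma splice_later a ys S' x n (h : n.+1.-tuple 'rV[R]_N) :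
  thead h \in ys -> @splice a ys S' n.+1 (cons_tuple x h) = S' (thead h) n h.
Proof.
have bh : [tuple of behead (cons_tuple x h)] = h :> n.+1.-tuple 'rV[R]_N.
  exact/val_inj.
rewrite /splice bh; elim: ys => //= y ys ih.
by rewrite in_cons; case: eqVneq => [->//|_ /ih].
Qed.

Lemma borel_splice a ys S' : admissible lam Lam a ->
  (forall y, borel_strategy lam Lam (S' y)) ->
  borel_strategy lam Lam (splice a ys S').
Proof.
move=> adm_a bS' [|n]; first by split => //; exact: measurable_cst.
have mbehead : measurable_fun setT
    (fun h : n.+2.-tuple 'rV[R]_N => [tuple of behead h] : n.+1.-tuple 'rV[R]_N).
  exact: measurable_behead.
split=> [|h] /=; elim: ys => [|y ys ih] //=.
  apply: measurable_fun_ifT => //.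
    apply: (@measurable_fun_bool _ _ _ _ true).
    rewrite setTI (_ : _ @^-1` _ = (fun h : n.+2.-tuple 'rV[R]_N =>
       thead ([tuple of behead h] : n.+1.-tuple 'rV[R]_N)) @^-1` [set y]); last first.
      by apply/seteqP; split => h /= /eqP.
    have mt := measurableT_comp (@measurable_tnth _ 'rV[R]_N n.+1 ord0) mbehead.
    by have := mt measurableT _ (measurable_set1_mx y); rewrite setTI.
  by apply: (measurableT_comp (bS' y n).1).
by case: ifP => // _; have [_] := bS' y n; exact.
Qed.

Lemma spliced_game_measure a x (S' : 'rV[R]_N -> strategy R N)
    (Q : 'rV[R]_N -> probability traj R) :
  Omega x -> admissible lam Lam a -> (forall y, borel_strategy lam Lam (S' y)) ->
  (forall y, game_measure Omega eps (S' y) y (Q y)) ->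
  let ys := successors eps x a in
  exists2 P, first_step x ys Q P & game_measure Omega eps (splice a ys S') x P.
Proof.
move=> Ox adm_a bS' gameQ ys.
have ys0 : (0 < size ys)%N by rewrite size_successors.
have [P Pstep] := first_step_ex x Q ys0; exists P => //.
have mS := borel_measurable_strategy (borel_splice ys adm_a bS').
split; first exact: first_step_starts_at Pstep.
case=> [|n].
  apply: (step_law_first mOmega ys0 mS _ _ Pstep).
    by move=> B; rewrite size_successors; exact: transitionE.
  by move=> y _; have [] := gameQ y.
apply: (step_law_later mOmega mS (S' := S') _ _ _ _ Pstep).
- by move=> y; exact: borel_measurable_strategy (bS' y).
- by move=> y h yys hy; rewrite splice_later ?hy.
- by move=> y _; have [] := gameQ y.
- by move=> y _; have [_] := gameQ y; exact.
Qed.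

End game_construction.

(** * The exit time *)

Section exit_time.
Context {R : realType} {N : nat}.
Local Notation traj := (g_sigma_algebraType (@cylinders R N)).
Local Notation move := ('M[R]_N * 'rV[R]_N)%type.
Implicit Types (x y : 'rV[R]_N) (a : move).
Variables (Omega : set 'rV[R]_N) (lam Lam eps r : R).
Hypotheses (mOmega : measurable Omega) (N_gt0 : (0 < N)%N).
Hypotheses (lam_gt0 : 0 < lam) (lam_lt_Lam : lam < Lam) (eps_gt0 : 0 < eps).
Hypothesis Omega_bounded : forall x, Omega x -> forall i, `|x 0 i| <= r.

Definition sqnorm x : R := \sum_(i < N) x 0 i ^+ 2.

Lemma sqnorm_ge0 x : 0 <= sqnorm x.
Proof. by apply: sumr_ge0 => i _; exact: sqr_ge0. Qed.

Lemma parallelogram x y : sqnorm (x + y) + sqnorm (x - y) = 2 * sqnorm x + 2 * sqnorm y.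
Proof.
rewrite /sqnorm !mulr_sumr -!big_split /=; apply: eq_bigr => i _.
by rewrite !mxE; ring.
Qed.

Lemma sqnorm_displacement a i : orthonormal_basis a.1 ->
  sqnorm (displacement eps a i) = eps ^+ 2 * a.2 0 i ^+ 2.
Proof.
move=> ortho; have oii := ortho i i; rewrite eqxx in oii.
rewrite -[RHS]mulr1 -[X in _ = _ * X]oii mulr_sumr.
by apply: eq_bigr => k _; rewrite !mxE; ring.
Qed.

Lemma sqnorm_displacement_bounds a i : admissible lam Lam a ->
  eps ^+ 2 * lam <= sqnorm (displacement eps a i) <= eps ^+ 2 * Lam.
Proof.
move=> [ortho mu]; rewrite sqnorm_displacement//.
have Lam_gt0 := lt_trans lam_gt0 lam_lt_Lam.
rewrite !ler_pM2l ?exprn_gt0//.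
by case: (mu i) => ->; rewrite sqr_sqrtr ?lexx ?ltW//.
Qed.

(** A bound for the squared norm of Omega and of all its successors: squared norms
    are at most N r^2 in Omega, those of displacements at most eps^2 Lam, and
    the parallelogram identity combines them. *)
Definition exit_radius2 : R := 2 * (N%:R * r ^+ 2) + 2 * (eps ^+ 2 * Lam).

Lemma sqnorm_inside x : Omega x -> sqnorm x <= N%:R * r ^+ 2.
Proof.
move=> Ox; rewrite /sqnorm mulr_natl -[X in _ *+ X]card_ord -sumr_const.
apply: ler_sum => i _; rewrite -[X in X <= _]real_normK ?num_real//.
have xr := Omega_bounded Ox i.
by rewrite lerXn2r// nnegrE (le_trans _ xr).
Qed.

Lemma sqnorm_successor x a y : Omega x -> admissible lam Lam a ->
  y \in successors eps x a -> sqnorm y <= exit_radius2.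
Proof.
move=> Ox adm; rewrite /exit_radius2.
have xle := sqnorm_inside Ox.
rewrite mem_cat => /orP[] /mapP[i _ ->];
  have /andP[_ dle] := sqnorm_displacement_bounds i adm;
  have := parallelogram x (displacement eps a i);
  have := sqnorm_ge0 (x + displacement eps a i);
  have := sqnorm_ge0 (x - displacement eps a i); lra.
Qed.

(** The submartingale property of the squared norm: the cross terms of x + d and
    x - d cancel, and every displacement has squared norm at least eps^2 lam. *)
Lemma average_sqnorm_successors x a : admissible lam Lam a ->
  sqnorm x + eps ^+ 2 * lam <=
    (2 * N)%:R^-1 * \sum_(y <- successors eps x a) sqnorm y.
Proof.
move=> adm; rewrite [leRHS]mulrC ler_pdivlMr ?ltr0n ?muln_gt0//.
rewrite big_cat !big_map -enumT !big_enum /= -big_split /=.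
under eq_bigr do rewrite parallelogram.
rewrite [leLHS](_ : _ = \sum_(i < N) (2 * sqnorm x + 2 * (eps ^+ 2 * lam))).
  apply: ler_sum => i _; have /andP[dge _] := sqnorm_displacement_bounds i adm.
  by rewrite lerD2l ler_pM2l.
by rewrite sumr_const card_ord -mulr_natl natrM; ring.
Qed.

Definition alive k : set traj := [set w | forall j, (j <= k)%N -> Omega (w j)].

Lemma measurable_alive k : measurable (alive k).
Proof.
rewrite (_ : alive k =
  \bigcap_(j in [set j | (j <= k)%N]) [set w : traj | Omega (w j)])//.
by apply: bigcap_measurableType => j _; exact: measurable_preimage_position.
Qed.

Lemma alive_prepend x k : Omega x -> prepend x @^-1` alive k.+1 = alive k.
Proof.
move=> Ox; apply/seteqP; split => w aw; first by move=> j jk; exact: (aw j.+1).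
by move=> [//|j] jk; exact: aw.
Qed.

Lemma alive_outside x (P : probability traj R) k :
  ~ Omega x -> P (starts_at x) = 1%E -> P (alive k) = 0%E.
Proof.
move=> nOx Px.
rewrite -(probability_setI_sure (measurable_alive k) (measurable_starts_at x) Px).
rewrite (_ : _ `&` _ = set0) ?measure0//.
by apply/seteqP; split => w // [/(_ 0%N (leq0n _)) + w0]; rewrite w0.
Qed.

Local Notation rate := (eps ^+ 2 * lam).

Let rate_gt0 : 0 < rate. Proof. by rewrite mulr_gt0// exprn_gt0. Qed.

(** The sum of the probabilities of being alive is the expected exit time,
    truncated at n.  A squared norm that grows by eps^2 lam per step on average
    but stays below exit_radius2 leaves room for (exit_radius2 - |x|^2) /
    (eps^2 lam) steps.  By induction on n, the first step costs 1 and lowers the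
    potential by at least 1. *)
Lemma sum_alive_le_potential n (S : strategy R N) x (P : probability traj R) :
  borel_strategy lam Lam S -> game_measure Omega eps S x P -> Omega x ->
  (\sum_(k < n) P (alive k) <= ((exit_radius2 - sqnorm x) / rate)%:E)%E.
Proof.
have c0 : 0 <= (2 * N)%:R^-1 :> R by rewrite invr_ge0.
elim: n S x P => [|n ih] S x P bS gameP Ox.
  rewrite big_ord0 lee_fin divr_ge0 ?(ltW rate_gt0)// subr_ge0 /exit_radius2.
  have Lam_gt0 := lt_trans lam_gt0 lam_lt_Lam.
  rewrite (le_trans (sqnorm_inside Ox))// -[leLHS]addr0 lerD//.
    by rewrite ler_peMl ?ler1n// mulr_ge0// sqr_ge0.
  by rewrite !mulr_ge0// ?sqr_ge0// ltW.
have mS := borel_measurable_strategy bS.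
have [Q Pstep gameQ] := game_measure_first_step mOmega N_gt0 mS Ox gameP.
have adm : admissible lam Lam (S 0%N [tuple x]) by have [_] := bS 0%N; exact.
have bcont := borel_continuation x bS.
rewrite big_ord_recl /=.
pose V y := (exit_radius2 - sqnorm y) / rate.
have Qle y : y \in successors eps x (S 0%N [tuple x]) ->
    (\sum_(k < n) Q y (alive k) <= (V y)%:E)%E.
  move=> yys; have [Oy|nOy] := pselect (Omega y); first exact: ih (gameQ y yys) Oy.
  rewrite big1; last by move=> k _; apply: alive_outside nOy _; case: (gameQ y yys).
  by rewrite lee_fin divr_ge0 ?(ltW rate_gt0)// subr_ge0 (sqnorm_successor Ox adm yys).
apply: (@le_trans _ _ (1%:E + ((2 * N)%:R^-1)%:E *
    \sum_(y <- successors eps x (S 0%N [tuple x])) (V y)%:E)%E).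
  apply: leeD; first exact: probability_le1 (measurable_alive 0).
  rewrite (eq_bigr (fun k : 'I_n => ((2 * N)%:R^-1)%:E *
      \sum_(y <- successors eps x (S 0%N [tuple x])) Q y (alive k))%E); last first.
    move=> k _; rewrite Pstep; last exact: measurable_alive.
    by rewrite size_successors alive_prepend.
  rewrite -ge0_sume_distrr; last by move=> k _; apply: sume_ge0.
  rewrite lee_pmul2l ?lte_fin ?invr_gt0 ?ltr0n ?muln_gt0//.
  by rewrite exchange_big /= big_seq [leRHS]big_seq; apply: lee_sum.
rewrite sumEFin -EFinM -EFinD lee_fin.
have avg := average_sqnorm_successors x adm.
have size_gt0 : (0 < 2 * N)%N by rewrite muln_gt0.
rewrite -mulr_suml sumrB big_const_seq count_predT size_successors iter_addr_0.
rewrite mulrA mulrBr -[X in _ * X - _]mulr_natl mulKf ?pnatr_eq0 -?lt0n//.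
rewrite -[X in X + _](divff (lt0r_neq0 rate_gt0)) -mulrDl ler_pM2r ?invr_gt0//.
lra.
Qed.

End exit_time.

(** * The payoff *)

Section payoff_expectation.
Context {R : realType} {N : nat}.
Local Notation traj := (g_sigma_algebraType (@cylinders R N)).
Implicit Types (x y : 'rV[R]_N) (w : traj) (P : probability traj R).
Variables (Omega : set 'rV[R]_N) (eps Cf Cg : R) (f g : 'rV[R]_N -> R).
Hypothesis mOmega : measurable Omega.
Hypotheses (mf : measurable_fun Omega f) (mg : measurable_fun (~` Omega) g).
Hypotheses (f_le : forall x, Omega x -> `|f x| <= Cf).
Hypotheses (g_le : forall x, ~ Omega x -> `|g x| <= Cg).
Hypotheses (Cf_ge0 : 0 <= Cf) (Cg_ge0 : 0 <= Cg).

Local Notation c := ((2 * N)%:R^-1 * eps ^+ 2).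
Local Notation pay := (payoff Omega eps f g).
Local Notation alive := (alive Omega).

Let c_ge0 : 0 <= c. Proof. by rewrite mulr_ge0// ?invr_ge0// sqr_ge0. Qed.

Let cCf_ge0 : 0 <= c * Cf. Proof. exact: mulr_ge0. Qed.

Definition exit_at n : set traj :=
  [set w | ~ Omega (w n) /\ forall k, (k < n)%N -> Omega (w k)].

Definition never_exit : set traj := [set w | forall n, Omega (w n)].

Lemma measurable_never_exit : measurable never_exit.
Proof.
rewrite (_ : never_exit = \bigcap_n [set w : traj | Omega (w n)]).
  by apply: bigcapT_measurable => n; exact: measurable_preimage_position.
by apply/seteqP; split => w Ow; [move=> n _|move=> n]; exact: Ow.
Qed.

Lemma measurable_exit_at n : measurable (exit_at n).
Proof.
rewrite (_ : exit_at n = [set w : traj | (~` Omega) (w n)] `&`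
    \bigcap_(k in [set k | (k < n)%N]) [set w : traj | Omega (w k)])//.
apply: measurableI; first by apply: measurable_preimage_position; exact: measurableC.
by apply: bigcap_measurableType => k _; exact: measurable_preimage_position.
Qed.

Lemma exit_cases w : never_exit w \/ exists n, exit_at n w.
Proof.
have [ex|nex] := pselect (exists n, ~ Omega (w n)); last first.
  by left => n; apply: contrapT => nO; apply: nex; exists n.
right; have exb : exists n, `[< ~ Omega (w n) >].
  by case: ex => n nO; exists n; exact/asboolP.
case: (ex_minnP exb) => n /asboolP nO minn; exists n; split => // k kn.
by apply: contrapT => /asboolP /minn; rewrite leqNgt kn.
Qed.

Lemma payoff_exit_at n w : exit_at n w ->
  pay w = g (w n) - c * \sum_(k < n) f (w k).
Proof.
move=> [nO Ok]; rewrite /payoff; case: pselect => [ex|[]]; last first.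
  by exists n; exact/asboolP.
have -> // : ex_minn ex = n.
case: ex_minnP => m /asboolP nOm minm; apply/eqP; rewrite eqn_leq.
rewrite minm; last exact/asboolP.
by rewrite leqNgt; apply/negP => /Ok.
Qed.

Lemma payoff_never_exit w : never_exit w -> pay w = 0.
Proof.
move=> never; rewrite /payoff; case: pselect => // ex.
by have [n /asboolP[]] := ex.
Qed.

(** A trajectory that never exits has payoff 0 by convention, which breaks this
    recursion; hence the exclusion of never_exit, which has probability 0. *)
Lemma payoff_prepend x w : Omega x -> ~ never_exit w ->
  pay (prepend x w) = - (c * f x) + pay w.
Proof.
move=> Ox nev; have [//|[n ew]] := exit_cases w.
have epw : exit_at n.+1 (prepend x w).
  by case: ew => nO Ok; split => // -[|k] //= /Ok.
rewrite (payoff_exit_at ew) (payoff_exit_at epw) big_ord_recl /= mulrDr.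
by ring.
Qed.

Lemma payoff_outside w : ~ Omega (w 0%N) -> pay w = g (w 0%N).
Proof.
move=> nO; rewrite (@payoff_exit_at 0) ?big_ord0 ?mulr0 ?subr0//.
Qed.

(** f and g are only controlled inside and outside Omega respectively; on each
    event of the countable partition by the exit time, the payoff evaluates
    them only there. *)
Lemma measurable_payoff : measurable_fun setT (pay : traj -> R).
Proof.
rewrite (_ : setT = \bigcup_n (if n is m.+1 then exit_at m else never_exit)); last first.
  apply/seteqP; split => // w _.
  by have [never|[n ew]] := exit_cases w; [exists 0%N|exists n.+1].
apply/measurable_fun_bigcup => [[|n]|[|n]].
- exact: measurable_never_exit.
- exact: measurable_exit_at.
- apply: (eq_measurable_fun (cst (0 : R) : traj -> R)); last exact: measurable_cst.
  by move=> w /set_mem /payoff_never_exit.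
- apply: (eq_measurable_fun (fun w : traj => g (w n) - c * \sum_(k < n) f (w k))).
    by move=> w /set_mem /payoff_exit_at.
  have mpos k : measurable_fun (exit_at n) (fun w : traj => w k).
    by apply: measurable_funTS; exact: measurable_position.
  apply: measurable_funB.
    apply: (measurable_comp (measurableC mOmega) _ mg (mpos n)).
    by move=> _ [w [nO _] <-].
  apply: measurable_funM => //; apply: measurable_sum => k.
  apply: (measurable_comp mOmega _ mf (mpos k)).
  by move=> _ [w [_ Ok] <-]; apply: Ok.
Qed.

(** The expected exit time is at most K. *)
Definition bounded_exit K P :=
  forall n, (\sum_(k < n) P (alive k) <= K%:E)%E.

(** never_exit is contained in every alive k, so that n copies of its probability
    stay below K for all n. *)
Lemma never_exit_null K P : bounded_exit K P -> P never_exit = 0%E.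
Proof.
move=> PK; have fin : P never_exit \is a fin_num.
  exact: fin_num_measure measurable_never_exit.
rewrite -(fineK fin); congr EFin; set p := fine _.
have p_ge0 : 0 <= p by exact/fine_ge0/measure_ge0.
apply/eqP; rewrite eq_le p_ge0 andbT leNgt; apply/negP => p_gt0.
have np n : n%:R * p <= K.
  rewrite -lee_fin; apply: le_trans (PK n).
  rewrite -[in leLHS](card_ord n) mulr_natl -sumr_const -sumEFin.
  apply: lee_sum => k _; rewrite /p fineK//.
  apply: le_measure; rewrite ?inE//; [exact: measurable_never_exit|
    exact: measurable_alive|].
  by move=> w never j _; exact: never.
have := np (Num.truncn (K / p)).+1; rewrite -ler_pdivlMr// leNgt.
by rewrite truncnS_gt.
Qed.

(** The series counts the steps before the exit, hence dominates the length of
    the running sum. *)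
Lemma payoff_le_alive w : (`|pay w|%:E <=
  Cg%:E + (c * Cf)%:E * \sum_(k <oo) (\1_(alive k) w)%:E)%E.
Proof.
have [never|[n ew]] := exit_cases w.
  rewrite payoff_never_exit// normr0; apply: adde_ge0; rewrite ?lee_fin//.
  by apply: mule_ge0 => //; apply: nneseries_ge0 => k _ _; rewrite lee_fin.
rewrite (payoff_exit_at ew); apply: (@le_trans _ _ (Cg + (c * Cf) * n%:R)%:E).
  rewrite lee_fin (le_trans (ler_normB _ _))// lerD//; first by apply: g_le; case: ew.
  rewrite normrM ger0_norm// -mulrA ler_wpM2l// (le_trans (ler_norm_sum _ _ _))//.
  rewrite mulr_natr -[X in _ *+ X]card_ord -sumr_const; apply: ler_sum => k _.
  by apply: f_le; case: ew => _; exact.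
rewrite EFinD leeD2l// [leLHS]EFinM lee_wpmul2l ?lee_fin//.
apply: le_trans _ (nneseries_lim_ge n _); last by move=> k _ _; rewrite lee_fin.
rewrite big_mkord (eq_bigr (fun=> 1%E)).
  by rewrite sumEFin sumr_const card_ord.
move=> k _; rewrite indicE mem_set// => j jk.
by case: ew => _; apply; exact: leq_ltn_trans jk (ltn_ord k).
Qed.

Lemma integral_payoff_le K P : bounded_exit K P ->
  (\int[P]_w `|(pay w)%:E| <= (Cg + c * Cf * K)%:E)%E.
Proof.
move=> PK; have mpay := measurable_payoff.
have malive k : measurable_fun setT (fun w : traj => (\1_(alive k) w)%:E : \bar R).
  by apply/measurable_EFinP; exact: measurable_indic (measurable_alive mOmega k).
have mseries : measurable_fun setT
    (fun w : traj => (\sum_(k <oo) (\1_(alive k) w)%:E)%E : \bar R).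
  by apply: ge0_emeasurable_sum => // k w _ _; rewrite lee_fin.
have series_ge0 w : (0 <= \sum_(k <oo) (\1_(alive k) w : R)%:E)%E.
  by apply: nneseries_ge0 => k _ _; rewrite lee_fin.
apply: (@le_trans _ _
    (\int[P]_w (Cg%:E + (c * Cf)%:E * \sum_(k <oo) (\1_(alive k) w)%:E))%E).
  apply: ge0_le_integral => //.
  - by apply: measurableT_comp => //; exact/measurable_EFinP.
  - by apply: emeasurable_funD => //; exact: emeasurable_funM.
  - by move=> w _; exact: payoff_le_alive.
rewrite ge0_integralD//; last 2 first.
- by move=> w _; apply: mule_ge0 => //; rewrite lee_fin.
- exact: emeasurable_funM.
rewrite integral_cst// [X in (_ * X)%E](probability_setT P) mule1.
rewrite ge0_integralZl ?lee_fin//.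
rewrite integral_nneseries//.
rewrite EFinD leeD2l// [leRHS]EFinM lee_wpmul2l ?lee_fin//.
apply: lime_le; first by apply: is_cvg_nneseries => k _ _; apply: integral_ge0.
near=> n; rewrite big_mkord; apply: le_trans (PK n).
apply: lee_sum => k _; rewrite integral_indic ?setIT//; exact: measurable_alive.
Unshelve. all: by end_near. Qed.

End payoff_expectation.

(** * Regularity of the data *)

Section data.
Context {R : realType} {N : nat}.

Lemma entry_le_norm (x : 'rV[R]_N) i : `|x 0 i| <= `|x|.
Proof.
rewrite [leRHS]mx_normrE.
exact: (le_bigmax (0 : R) (fun ij : 'I_1 * 'I_N => `|x ij.1 ij.2|) (0, i)).
Qed.

Lemma bounded_near_le (T : Type) (V : normedModType R) (A : set T) (h : T -> V) :
  [bounded h t | t in A] ->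
  exists2 C : R, 0 <= C & forall t, A t -> `|h t| <= C.
Proof.
move=> [M [_ hM]]; exists (`|M| + 1); first by rewrite addr_ge0.
by apply: hM; rewrite (le_lt_trans (ler_norm M))// ltrDl.
Qed.

(** The topology of row vectors is given by the sup norm; the factor N+1, rather
    than N, gives a strict inequality in every dimension. *)
Lemma enorm_lt_ball (x y : 'rV[R]_N) (d : R) : 0 < d ->
  (forall i, `|x 0 i - y 0 i| < d / N.+1%:R) -> enorm (x - y) < d.
Proof.
move=> d0 xy; rewrite /enorm -[ltRHS](ger0_norm (ltW d0)) -sqrtr_sqr.
rewrite ltr_sqrt ?exprn_gt0//.
apply: (@le_lt_trans _ _ (\sum_(i < N) (d / N.+1%:R) ^+ 2)).
  apply: ler_sum => i _; rewrite !mxE -[leLHS]real_normK ?num_real//.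
  by rewrite lerXn2r ?nnegrE ?normr_ge0 ?divr_ge0 ?ltW.
rewrite sumr_const card_ord -(mulr_natl (_ ^+ 2) N) exprMn mulrCA -[ltRHS]mulr1.
rewrite ltr_pM2l ?exprn_gt0// exprVn ltr_pdivrMr ?exprn_gt0// mul1r -natrX ltr_nat.
by rewrite expnS expn1 mulSn (leq_trans (ltnSn N)) ?leq_addr.
Qed.

Lemma uniformly_continuous_measurable (Omega : set 'rV[R]_N) (f : 'rV[R]_N -> R) :
  open Omega -> uniformly_continuous_on Omega f -> measurable_fun Omega f.
Proof.
move=> oO unif; apply: continuous_measurable_fun_mx; first exact: open_measurable_mx.
apply: continuous_in_subspaceT => x /set_mem Ox.
apply/(@cvgrPdist_lt _ _ _ _ (nbhs_filter x)) => e e0.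
have [d d0 fd] := unif e e0.
have dN0 : 0 < d / N.+1%:R by rewrite divr_gt0.
have nO : nbhs x Omega by exact: open_nbhs_nbhs.
have nB : nbhs x (ball x (d / N.+1%:R)) by exact: nbhsx_ballx.
near=> y.
have [_ xy] : ball x (d / N.+1%:R) y by near: y.
apply: fd => //; first by near: y.
by apply: enorm_lt_ball => // i; have := xy 0 i; rewrite -ball_normE.
Unshelve. all: by end_near. Qed.

End data.

(** * The value function *)

Section value.
Context {R : realType} {N : nat}.
Local Notation traj := (g_sigma_algebraType (@cylinders R N)).
Implicit Types (x y : 'rV[R]_N) (w : traj) (P : probability traj R).
Variables (Omega : set 'rV[R]_N) (lam Lam eps r Cf Cg : R) (f g : 'rV[R]_N -> R).
Hypotheses (mOmega : measurable Omega) (N_gt0 : (0 < N)%N).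
Hypotheses (lam_gt0 : 0 < lam) (lam_lt_Lam : lam < Lam) (eps_gt0 : 0 < eps).
Hypothesis Omega_bounded : forall x, Omega x -> forall i, `|x 0 i| <= r.
Hypotheses (mf : measurable_fun Omega f) (mg : measurable_fun (~` Omega) g).
Hypotheses (f_le : forall x, Omega x -> `|f x| <= Cf).
Hypotheses (g_le : forall x, ~ Omega x -> `|g x| <= Cg).
Hypotheses (Cf_ge0 : 0 <= Cf) (Cg_ge0 : 0 <= Cg).

Local Notation c := ((2 * N)%:R^-1 * eps ^+ 2).
Local Notation pay := (payoff Omega eps f g).

(* The absolute value makes the bound nonnegative, as needed outside Omega. *)
Definition exit_bound : R := `|exit_radius2 (N := N) Lam eps r / (eps ^+ 2 * lam)|.

Lemma game_bounded_exit S x P : borel_strategy lam Lam S ->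
  game_measure Omega eps S x P -> bounded_exit Omega exit_bound P.
Proof.
move=> bS gameP n; have [Ox|nOx] := pselect (Omega x).
  apply: le_trans (sum_alive_le_potential mOmega N_gt0 lam_gt0 lam_lt_Lam
    eps_gt0 Omega_bounded n bS gameP Ox) _.
  rewrite lee_fin (le_trans _ (ler_norm _))// ler_pM2r.
    by rewrite gerBl sqnorm_ge0.
  by rewrite invr_gt0 mulr_gt0// exprn_gt0.
rewrite big1 ?lee_fin ?normr_ge0// => k _.
by apply: (alive_outside mOmega k nOx); case: gameP.
Qed.

Lemma expectation_payoffE P : ('E_P[pay] = \int[P]_w (pay w)%:E)%E.
Proof. by rewrite unlock. Qed.

Lemma integrable_payoff K P : bounded_exit Omega K P ->
  P.-integrable setT (EFin \o pay).
Proof.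
move=> PK; apply/integrableP; split.
  by apply/measurable_EFinP; exact: measurable_payoff.
apply: le_lt_trans (ltry (Cg + c * Cf * K)).
exact: (integral_payoff_le eps mOmega mf mg f_le g_le Cf_ge0 Cg_ge0 PK).
Qed.

Lemma expectation_payoff_fin_num K P : bounded_exit Omega K P ->
  ('E_P[pay] \is a fin_num)%E.
Proof.
move=> PK; rewrite expectation_payoffE.
exact: integrable_fin_num (integrable_payoff PK).
Qed.

(** Running the payoff recursion along the first step.  The recursion fails on
    trajectories that never exit, a null event on every branch. *)
Lemma expectation_first_step K x ys Q P : Omega x -> (0 < size ys)%N ->
  first_step x ys Q P -> (forall y, y \in ys -> bounded_exit Omega K (Q y)) ->
  ('E_P[pay] = (- (c * f x))%:E +
     ((size ys)%:R^-1)%:E * \sum_(y <- ys) 'E_(Q y)[pay])%E.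
Proof.
move=> Ox ys_gt0 Pstep QK.
have mpay := measurable_payoff eps mOmega mf mg.
have mnever : measurable (~` @never_exit R N Omega).
  by apply: measurableC; exact: measurable_never_exit.
have mpp : measurable_fun setT (pay \o prepend x).
  exact: (measurableT_comp mpay (measurable_prepend x)).
have mEpp : measurable_fun setT (EFin \o (pay \o prepend x)) by exact/measurable_EFinP.
have icst y : (Q y).-integrable setT (EFin \o cst (- (c * f x))).
  exact: finite_measure_integrable_cst.
have shiftE y : y \in ys ->
    (\int[Q y]_w (pay (prepend x w))%:E = (- (c * f x))%:E + 'E_(Q y)[pay])%E.
  move=> yys; have exits : Q y (~` @never_exit R N Omega) = 1%E.
    rewrite probability_setC; last exact: measurable_never_exit.
    by rewrite (never_exit_null mOmega (QK y yys)) sube0.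
  have mpsi : measurable_fun setT ((EFin \o cst (- (c * f x))%R) \+ (EFin \o pay))%E.
    apply: emeasurable_funD; last exact/measurable_EFinP.
    exact: (measurable_cst (- (c * f x))%:E).
  apply: etrans (integral_sure measurableT mnever exits mEpp mpsi _) _.
    by move=> w _ nev /=; rewrite payoff_prepend.
  rewrite (integralD_EFin measurableT (icst y) (integrable_payoff (QK y yys))).
  rewrite expectation_payoffE; congr (_ + _)%E.
  apply: etrans (integral_cst (Q y) measurableT (- (c * f x))%:E) _.
  by rewrite [X in (_ * X)%E](probability_setT (Q y)) mule1.
have ipp y : y \in ys -> (Q y).-integrable setT (EFin \o (pay \o prepend x)).
  move=> yys.
  have iabs : (Q y).-integrable setT
      ((EFin \o cst `|c * f x|%R) \+ (abse \o (EFin \o pay)))%E.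
    apply: integrableD => //; first exact: finite_measure_integrable_cst.
    exact/integrable_abse/(integrable_payoff (QK y yys)).
  apply: le_integrable iabs => //.
  move=> w _ /=; rewrite lee_fin [leRHS]ger0_norm ?addr_ge0//.
  have [never|nev] := pselect (never_exit Omega w).
    rewrite payoff_never_exit ?normr0 ?addr_ge0//.
    by case=> //= n; exact: never.
  by rewrite payoff_prepend// (le_trans (ler_normD _ _))// normrN.
rewrite expectation_payoffE (integral_first_step Pstep mpay ipp).
rewrite (eq_big_seq _ shiftE).
have EE y : y \in ys -> ('E_(Q y)[pay] = (fine ('E_(Q y)[pay]))%:E)%E.
  by move=> yys; rewrite fineK//; exact: expectation_payoff_fin_num (QK y yys).
rewrite (eq_big_seq (fun y => (- (c * f x) + fine ('E_(Q y)[pay])%E)%:E)); last first.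
  by move=> y yys; rewrite [X in (_ + X)%E]EE.
rewrite [in RHS](eq_big_seq (fun y => (fine ('E_(Q y)[pay])%E)%:E)); last exact: EE.
rewrite !sumEFin -!EFinM -EFinD big_split mulrDr; congr ((_ + _)%:E).
rewrite big_const_seq count_predT iter_addr_0 -(mulr_natl (- (c * f x))).
by rewrite mulKf// pnatr_eq0 -lt0n.
Qed.

Local Notation u := (game_value Omega lam Lam eps f g).

Lemma abs_expectation_payoff_le S x P :
  borel_strategy lam Lam S -> game_measure Omega eps S x P ->
  (`|'E_P[pay]| <= (Cg + c * Cf * exit_bound)%:E)%E.
Proof.
move=> bS gameP; have PK := game_bounded_exit bS gameP.
apply: le_trans (integral_payoff_le eps mOmega mf mg f_le g_le Cf_ge0 Cg_ge0 PK).
rewrite expectation_payoffE; apply: le_abse_integral => //.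
by apply/measurable_EFinP; exact: measurable_payoff.
Qed.

Lemma admissible_ex : exists a, admissible (N := N) lam Lam a.
Proof.
exists (1%:M, const_mx (Num.sqrt lam)); split; last by move=> i; left; rewrite mxE.
move=> i j; under eq_bigr do rewrite !mxE.
rewrite (bigD1 j)//= big1 ?addr0; last first.
  by move=> k kj; rewrite [j == k]eq_sym (negPf kj) mulr0.
by rewrite eqxx mulr1.
Qed.

Lemma game_ex x : exists S P, borel_strategy lam Lam S /\ game_measure Omega eps S x P.
Proof.
have [a adm_a] := admissible_ex.
have [P gameP] := constant_game_measure_ex eps mOmega N_gt0 a x.
exists (constant_strategy a), P; split => // n.
by split => //; exact: measurable_cst.
Qed.

Lemma expectation_le_game_value S x P :
  borel_strategy lam Lam S -> game_measure Omega eps S x P -> ('E_P[pay] <= u x)%E.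
Proof. by move=> bS gameP; apply: ereal_sup_ubound; exists S, P. Qed.

Lemma game_value_fin_num x : u x \is a fin_num.
Proof.
have [S [P [bS gameP]]] := game_ex x.
rewrite fin_numElt; apply/andP; split.
  apply: lt_le_trans (expectation_le_game_value bS gameP).
  have := expectation_payoff_fin_num (game_bounded_exit bS gameP).
  by rewrite fin_numElt => /andP[].
apply: (@le_lt_trans _ _ (Cg + c * Cf * exit_bound)%:E); last exact: ltry.
apply: ge_ereal_sup => _ [S' [P' [bS' gameP' ->]]].
by apply: le_trans (lee_abs _) _; exact: abs_expectation_payoff_le gameP'.
Qed.

Lemma game_value_outside x : ~ Omega x -> u x = (g x)%:E.
Proof.
move=> nOx; have E S P : borel_strategy lam Lam S ->
    game_measure Omega eps S x P -> ('E_P[pay] = (g x)%:E)%E.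
  move=> bS [Px _]; rewrite expectation_payoffE.
  have mpay := measurable_payoff eps mOmega mf mg.
  have mEpay : measurable_fun setT (EFin \o pay) by exact/measurable_EFinP.
  apply: etrans (integral_sure measurableT (measurable_starts_at x) Px mEpay
    (measurable_cst (g x)%:E) _) _.
    by move=> w _ /= w0; rewrite payoff_outside w0.
  by rewrite integral_cst// [X in (_ * X)%E](probability_setT P) mule1.
have [S [P [bS gameP]]] := game_ex x.
rewrite /game_value -[RHS]ereal_sup1; congr ereal_sup; apply/seteqP; split => e /=.
  by move=> [S' [P' [bS' gameP' ->]]]; exact: E gameP'.
by move=> ->; exists S, P; split => //; rewrite (E S).
Qed.

Let step_value x a : \bar R := (\sum_(y <- successors eps x a) u y)%E.

(** A game from x, conditioned on its first position y, is a game from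
    y and earns at most u y. *)
Lemma game_value_le x : Omega x ->
  (u x <= (- (c * f x))%:E + ((2 * N)%:R^-1)%:E *
     ereal_sup [set step_value x a | a in admissible lam Lam])%E.
Proof.
move=> Ox; apply: ge_ereal_sup => _ [S [P [bS gameP ->]]].
have mS := borel_measurable_strategy bS.
have adm : admissible lam Lam (S 0%N [tuple x]) by have [_] := bS 0%N; exact.
have [Q Pstep gameQ] := game_measure_first_step mOmega N_gt0 mS Ox gameP.
have bcont := borel_continuation x bS.
rewrite (@expectation_first_step exit_bound x (successors eps x (S 0%N [tuple x])) Q)//.
- rewrite size_successors leeD2l// lee_pmul2l ?lte_fin ?invr_gt0 ?ltr0n ?muln_gt0//.
  apply: (@le_trans _ _ (step_value x (S 0%N [tuple x]))).
    rewrite /step_value big_seq [leRHS]big_seq; apply: lee_sum => y yys.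
    exact: expectation_le_game_value (gameQ y yys).
  by apply: ereal_sup_ubound; exists (S 0%N [tuple x]).
- by rewrite size_successors muln_gt0.
- by move=> y yys; exact: game_bounded_exit (gameQ y yys).
Qed.

(** For a given first move, continue with nearly optimal strategies from its finitely
    many successors; the spliced strategy competes for the value at x. *)
Lemma game_value_ge x : Omega x ->
  ((- (c * f x))%:E + ((2 * N)%:R^-1)%:E *
     ereal_sup [set step_value x a | a in admissible lam Lam] <= u x)%E.
Proof.
move=> Ox; have ux := fineK (game_value_fin_num x).
have M_gt0 : 0 < (2 * N)%:R :> R by rewrite ltr0n muln_gt0.
rewrite -ux addeC -leeBrDr// -EFinB lee_pdivrMl// -EFinM.
apply: ge_ereal_sup => _ [a adm_a <-].
have stepE : step_value x a = (\sum_(y <- successors eps x a) fine (u y))%:E.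
  by rewrite -sumEFin; apply: eq_bigr => y _; rewrite fineK// game_value_fin_num.
rewrite stepE lee_fin; apply/ler_addgt0Pr => e e_gt0.
(* the losses of the 2N successors add up to e *)
pose h := e / (2 * N)%:R; have h_gt0 : 0 < h by exact: divr_gt0.
have /choice[SP SPP] : forall y, exists SP : strategy R N * probability traj R,
    [/\ borel_strategy lam Lam SP.1, game_measure Omega eps SP.1 y SP.2 &
      (u y - h%:E <= 'E_(SP.2)[pay])%E].
  move=> y; have [_ [S [P [bS gameP ->]]] lt] :=
    ub_ereal_sup_adherent h_gt0 (game_value_fin_num y).
  by exists (S, P); split => //; exact: ltW.
have bSP y : borel_strategy lam Lam (SP y).1 by have [] := SPP y.
have gSP y : game_measure Omega eps (SP y).1 y (SP y).2 by have [] := SPP y.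
have [P Pstep gameP] := spliced_game_measure (S' := fun y => (SP y).1)
  (Q := fun y => (SP y).2) mOmega N_gt0 Ox adm_a bSP gSP.
have bS := borel_splice (S' := fun y => (SP y).1) (successors eps x a) adm_a bSP.
have := expectation_le_game_value bS gameP.
rewrite (@expectation_first_step exit_bound x (successors eps x a)
  (fun y => (SP y).2))//; first last.
- by move=> y _; exact: game_bounded_exit (gSP y).
- by rewrite size_successors muln_gt0.
rewrite size_successors -ux.
have Efin y : ('E_((SP y).2)[pay] = (fine ('E_((SP y).2)[pay])%E)%:E)%E.
  rewrite fineK//.
  exact: expectation_payoff_fin_num (game_bounded_exit (bSP y) (gSP y)).
under eq_bigr do rewrite Efin.
rewrite sumEFin -EFinM -EFinD lee_fin => le_ux.
have : \sum_(y <- successors eps x a) fine (u y) <=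
    \sum_(y <- successors eps x a) (fine ('E_((SP y).2)[pay])%E + h).
  apply: ler_sum => y _; have [_ _] := SPP y.
  by rewrite Efin -(fineK (game_value_fin_num y)) -EFinB lee_fin lerBlDr.
move=> /le_trans; apply.
rewrite big_split /= big_const_seq count_predT size_successors iter_addr_0.
rewrite -(mulr_natl h) /h mulrC divfK ?gt_eqF// lerD2r.
rewrite -ler_pdivrMl//; lra.
Qed.

End value.

Theorem theorem1 (R : realType) (N : nat) (Omega : set 'rV[R]_N)
    (lam Lam eps : R) (f g : 'rV[R]_N -> R)
    (N_gt0 : (0 < N)%N)
    (Omega_domain : bounded_domain Omega)
    (Omega_sphere : uniform_exterior_sphere Omega)
    (lam_gt0 : 0 < lam) (lam_lt_Lam : lam < Lam)
    (f_unif : uniformly_continuous_on Omega f)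
    (f_bounded : [bounded f x | x in Omega])
    (g_cont : {within ~` Omega, continuous g})
    (g_bounded : [bounded g x | x in ~` Omega])
    (eps_gt0 : 0 < eps) :
  let u := game_value Omega lam Lam eps f g in
  (forall x, u x \is a fin_num) /\
  (forall x, Omega x ->
    u x = ((- ((2 * N)%:R^-1 * eps ^+ 2 * f x))%R%:E +
           ((2 * N)%:R^-1)%:E *
           ereal_sup [set (\sum_(i < N) (u (x + displacement eps a i)%R
                                         + u (x - displacement eps a i)%R))%E
                     | a in admissible lam Lam])%E) /\
  (forall x, ~ Omega x -> u x = (g x)%:E).
Proof.
move=> u; have [oOmega _ _ bOmega] := Omega_domain.
have mOmega : measurable Omega by exact: open_measurable_mx.
have mf := uniformly_continuous_measurable oOmega f_unif.
have mg := continuous_measurable_fun_mx (measurableC mOmega) g_cont.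
have [r _ Omega_le] := bounded_near_le bOmega.
have entries_le x : Omega x -> forall i, `|x 0 i| <= r.
  by move=> Ox i; exact: le_trans (entry_le_norm x i) (Omega_le x Ox).
have [Cf Cf0 f_le] := bounded_near_le f_bounded.
have [Cg Cg0 g_le] := bounded_near_le g_bounded.
split.
  move=> x; exact: (game_value_fin_num mOmega N_gt0 lam_gt0 lam_lt_Lam eps_gt0
    entries_le mf mg f_le g_le).
split; last first.
  by move=> x nOx; exact: game_value_outside.
move=> x Ox.
rewrite (_ : [set _ | a in _] =
    [set (\sum_(y <- successors eps x a) u y)%E | a in admissible lam Lam]).
  apply/le_anti/andP; split.
    exact: (game_value_le mOmega N_gt0 lam_gt0 lam_lt_Lam eps_gt0 entries_le mf
      mg f_le g_le).
  exact: (game_value_ge mOmega N_gt0 lam_gt0 lam_lt_Lam eps_gt0 entries_le mf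
      mg f_le g_le).
by congr image; apply/funext => a; rewrite big_successors.
Qed.
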